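(* Let $A\in\mathbb{Z}^{r\times n}$ of rank $r$ and $\mathbf{b}\in\mathbb{Z}^r$, and let $\mathcal{P}=\{\alpha\in\mathbb{R}^n_{\ge0}:A\alpha=\mathbf{b}\}$ be a polytope of dimension $d=n-r$, with $\mathrm{cone}(\mathcal{P})=\{\alpha\in\mathbb{R}^{n+1}_{\ge0}:B\alpha=0\}$ where $B=(A,-\mathbf{b})$. Let the Smith Normal Form of $B$ be $\bigl(\mathrm{diag}(d_1,\dots,d_r),\mathbf{0}\bigr)$. Suppose the algorithm Simpcone, applied to $B$, gives a weighted simplicial cone decomposition $\sum_i s_iK(V_i)$ of $\mathrm{cone}(\mathcal{P})$ (i.e. $\sigma_{\mathrm{cone}(\mathcal{P})}=\sum_i s_i\sigma_{K(V_i)}$) with $\mathrm{rank}(V_i)=d+1$. Then for any $\beta\in\mathbb{Z}^n$ admissible for all $V_i$, the relative volume is $$\mathrm{vol}(\mathcal{P})=\frac{1}{d!}\sum_i s_i\,\widehat{\mathrm{Vol}}_d^\beta K(V_i),\qquad \widehat{\mathrm{Vol}}_d^\beta K(V_i)=\left|\frac{d_1\cdots d_r}{p_{i,1}\cdots p_{i,r}}\right|\mathrm{CT}_q\frac{1}{\prod_{j=1}^{d+1}(m_{i,j}-(\beta^T\nu_{i,j})q)},$$ where $V_i=(\mu_{i,1},\dots,\mu_{i,d+1})$, $\mu_{i,j}=(\nu_{i,j}^T,m_{i,j})^T$ with $\nu_{i,j}\in\mathbb{Q}^n$, $m_{i,j}\in\mathbb{Q}$, and $p_{i,1},\dots,p_{i,r}$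 are the pivot items used in obtaining $V_i$.
   Context: Relative volume: $\mathrm{vol}(\mathcal{P})=\lim_{s\to\infty}s^{-d}\#(s\mathcal{P}\cap\mathbb{Z}^n)$. $\sigma_S(\mathbf{y})=\sum_{\alpha\in S\cap\mathbb{Z}^{n+1}}\mathbf{y}^\alpha$; $K(V)$ is the cone generated by the columns of $V$. $\beta$ is admissible for $V_i$ if for all $j$, $\beta^T\nu_{i,j}$ and $m_{i,j}$ are not both $0$. $\mathrm{CT}_q$ is the constant term of the Laurent expansion in $q$ at $q=0$. Pivot operation: for a matrix $M$ with $N$ top rows and $r$ bottom rows, $M\leftarrow(i,j)$ performs Gaussian column elimination using the nonzero entry $m_{N+i,j}$ (the pivot item): each other non-ignored column $k$ is replaced by column $k$ minus $(m_{N+i,k}/m_{N+i,j})$ times column $j$; then row $N+i$ and column $j$ are ignored (deleted after all $r$ pivots). Algorithm Simpcone: start with $M=\begin{pmatrix}E_{n+1}\\ B\end{pmatrix}$ ($N=n+1$) and list $\{(1,M,\varnothing,\varnothing)\}$. A column is small if its first nonzero entry is positive, large otherwise. For unprocessed bottom row $i$ and non-ignored column $\gamma_j$: contributing if $m_{N+i,j}\gamma_j$ is small, dually contributing if it is large; $\mathfrak{c}^\pm_i$ are their counts. $\mathrm{CT}_i\overline{M}\langle I;J\rangle=\sum_{j\text{ contributing}}\mathrm{sgn}(m_{N+i,j})\overline{M}\langle I\cup\{i\};J\cup\{j\}\rangle=\sum_{j\text{ dually contributing}}-\mathrm{sgn}(m_{N+i,j})\overline{M}\langle I\cup\{i\};J\cup\{j\}\rangle$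 (first form if $\mathfrak{c}^+_i\le\mathfrak{c}^-_i$, else second). In each of $r$ rounds each weighted term $(s,O,I,J)$ is replaced by $s\,\mathrm{CT}_iO$ for a row $i\notin I$ minimizing $\min(\mathfrak{c}^+_i,\mathfrak{c}^-_i)$, and equal matrices are collected; the output is the list of $(s_i,V_i)$, $V_i\in\mathbb{Q}^{(n+1)\times(d+1)}$.
   Formalization: The limit defining vol(P) is assumed to exist; it need not (A=(2), b=(1), P={1/2} gives counts 1,0,1,0,… with no limit, while the formula gives 1/2). *)

(* Defs.v *)
From HB Require Import structures.
From mathcomp Require Export all_boot all_order all_algebra.
From mathcomp Require Export finmap.
From mathcomp Require Export all_classical all_reals all_analysis.
Set Implicit Arguments.
Unset Strict Implicit.
Unset Printing Implicit Defensive.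
Export Order.TTheory GRing.Theory Num.Theory.
Export numFieldNormedType.Exports.

#[global] Open Scope classical_set_scope.
#[global] Open Scope ring_scope.

Definition polyP (R : realType) (r n : nat)
    (A : 'M[int]_(r, n)) (b : 'cV[int]_r) : set 'cV[R]_n :=
  [set x : 'cV[R]_n | (forall i, 0 <= x i 0) /\ map_mx intr A *m x = map_mx intr b].

Definition coneP (R : realType) (r N : nat) (B : 'M[int]_(r, N)) :
    set 'cV[R]_N :=
  [set x : 'cV[R]_N | (forall i, 0 <= x i 0) /\ map_mx intr B *m x = 0].

(* K(V): nonnegative real combinations of the columns of V *)
Definition cone_gen (R : realType) (N k : nat) (V : 'M[rat]_(N, k)) :
    set 'cV[R]_N :=
  [set x : 'cV[R]_N | exists c : 'cV[R]_k, (forall j, 0 <= c j 0) /\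
                                x = map_mx ratr V *m c].

Arguments polyP R {r n} A b.
Arguments coneP R {r N} B.
Arguments cone_gen R {N k} V.

Definition coord_bounded (R : realType) (n : nat) (P : set 'cV[R]_n) : Prop :=
  exists M : R, forall x, P x -> forall i, `|x i 0| <= M.

Definition affinely_independent (R : realType) (n k : nat)
    (x : 'I_k -> 'cV[R]_n) : Prop :=
  row_free (\matrix_(i < k) row_mx (x i)^T (1%:M : 'M[R]_1)).

Definition has_dimension (R : realType) (n : nat) (P : set 'cV[R]_n)
    (d : nat) : Prop :=
  (exists x : 'I_d.+1 -> 'cV[R]_n,
      (forall i, P (x i)) /\ affinely_independent x) /\
  (forall (k : nat) (x : 'I_k -> 'cV[R]_n),
      (forall i, P (x i)) -> affinely_independent x -> (k <= d.+1)%N).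

(* #(sP \cap Z^n); [fset_set] is only meaningful on finite sets, which is the
   case here as soon as P is bounded *)
Definition lattice_count (R : realType) (n : nat) (P : set 'cV[R]_n)
    (s : nat) : nat :=
  #|` fset_set [set z : 'cV[int]_n |
                 [set s%:R *: x | x in P] (map_mx intr z)] |%fset.

Definition dilation_ratio (R : realType) (n : nat) (P : set 'cV[R]_n)
    (d : nat) : nat -> R :=
  fun s => (s%:R ^+ d)^-1 * (lattice_count P s)%:R.

Definition relative_volume (R : realType) (n : nat) (P : set 'cV[R]_n)
    (d : nat) : R :=
  limn (dilation_ratio P d).

(* The invariants are fixed only up to sign, as in [int_Smith_normal_form]. *)
Definition smith_normal_form (r N : nat) (B : 'M[int]_(r, N))
    (D : 'I_r -> int) : Prop :=
  (forall i j : 'I_r, (i <= j)%N -> (D i %| D j)%Z) /\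
  exists (L : 'M[int]_r) (U : 'M[int]_N),
    [/\ L \in unitmx, U \in unitmx &
        L *m B *m U = \matrix_(i < r, j < N) (D i *+ (i == j :> nat))].

(* A formal Laurent series is given by its coefficients y^a |-> F a, with
   support arbitrary in Z^N. *)
Definition sigma (R : realType) (N : nat) (S : set 'cV[R]_N) :
    'cV[int]_N -> rat :=
  fun a => (`[< S (map_mx intr a) >])%:R.

Definition laurent_poly (N : nat) (f : 'cV[int]_N -> rat) : Prop :=
  finite_set [set a | f a != 0].

(* The product of a Laurent polynomial and a formal Laurent series. *)
Definition lmul (N : nat) (f F : 'cV[int]_N -> rat) : 'cV[int]_N -> rat :=
  fun a => \sum_(e \in [set e | f e != 0]) f e * F (a - e).

(* A series F with f F = p, where f != 0 and p are Laurent polynomials,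
   stands for the rational function p / f. The identity F = sum_i s_i G_i
   below is between rational functions (the cones K(V_i) need not lie in a
   common pointed cone): written over a common denominator f,
   (f F) / f = sum_i s_i (f G_i) / f. *)
Definition ratfun_eq_sum (N k : nat) (F : 'cV[int]_N -> rat)
    (s : 'I_k -> int) (G : 'I_k -> 'cV[int]_N -> rat) : Prop :=
  exists f : 'cV[int]_N -> rat,
    [/\ laurent_poly f, exists a, f a != 0,
        laurent_poly (lmul f F), forall i, laurent_poly (lmul f (G i)) &
        forall a, lmul f F a = \sum_(i < k) (s i)%:~R * lmul f (G i) a].

(* The zero column has no first nonzero entry, hence is neither small nor
   large. *)
Definition small (m : nat) (v : 'cV[rat]_m) : bool :=
  [exists i : 'I_m, (0 < v i 0) &&
     [forall k : 'I_m, (k < i)%N ==> (v k 0 == 0)]].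

Definition large (m : nat) (v : 'cV[rat]_m) : bool :=
  [exists i : 'I_m, (v i 0 < 0) &&
     [forall k : 'I_m, (k < i)%N ==> (v k 0 == 0)]].

(* A weighted term (s, O, I, J), with I (resp. J) the ignored bottom rows
   (resp. columns) of O, together with the pivot items used so far. Ignored
   rows and columns stay in the matrix, but are never looked at. *)
Record wterm (n r : nat) := WTerm {
  weight : int;
  mat : 'M[rat]_((n + 1) + r, n + 1);
  irows : {set 'I_r};
  icols : {set 'I_(n + 1)};
  pivots : seq rat }.

Definition bot (n r : nat) (t : wterm n r) (i : 'I_r) (j : 'I_(n + 1)) : rat :=
  mat t (rshift (n + 1) i) j.

Definition pivot_mx (n r : nat) (t : wterm n r) (i : 'I_r) (j : 'I_(n + 1)) :
    'M[rat]_((n + 1) + r, n + 1) :=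
  \matrix_(a, k) if (k == j) || (k \in icols t) then mat t a k
                 else mat t a k - bot t i k / bot t i j * mat t a j.

(* t <- (i, j), the weight being multiplied by e *)
Definition pivot (n r : nat) (t : wterm n r) (e : int) (i : 'I_r)
    (j : 'I_(n + 1)) : wterm n r :=
  WTerm (weight t * e) (pivot_mx t i j) (i |: irows t)%SET (j |: icols t)%SET
        (rcons (pivots t) (bot t i j)).

Definition contributing (n r : nat) (t : wterm n r) (i : 'I_r) :
    {set 'I_(n + 1)} :=
  [set j | (j \notin icols t) && small (bot t i j *: col j (mat t))]%SET.

Definition dually_contributing (n r : nat) (t : wterm n r) (i : 'I_r) :
    {set 'I_(n + 1)} :=
  [set j | (j \notin icols t) && large (bot t i j *: col j (mat t))]%SET.

Definition CT_row (n r : nat) (t : wterm n r) (i : 'I_r) : seq (wterm n r) :=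
  if (#|contributing t i| <= #|dually_contributing t i|)%N
  then [seq pivot t (sgz (bot t i j)) i j | j <- enum (contributing t i)]
  else [seq pivot t (- sgz (bot t i j)) i j
       | j <- enum (dually_contributing t i)].

Definition row_cost (n r : nat) (t : wterm n r) (i : 'I_r) : nat :=
  minn #|contributing t i| #|dually_contributing t i|.

Definition best_row (n r : nat) (t : wterm n r) (i : 'I_r) : Prop :=
  i \notin irows t /\
  forall i', i' \notin irows t -> (row_cost t i <= row_cost t i')%N.

(* Every term is replaced; ties between best rows are resolved arbitrarily. *)
Inductive expand (n r : nat) : seq (wterm n r) -> seq (wterm n r) -> Prop :=
| expand_nil : expand [::] [::]
| expand_cons t i ts us :
    best_row t i -> expand ts us -> expand (t :: ts) (CT_row t i ++ us).

Definition visible_mx (n r : nat) (t : wterm n r) :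
    'M[rat]_((n + 1) + r, n + 1) :=
  \matrix_(a, k)
    if (k \in icols t) || (if fintype.split a is inr i then i \in irows t else false)
    then 0 else mat t a k.

Definition same_matrix (n r : nat) (t u : wterm n r) : bool :=
  [&& irows t == irows u, icols t == icols u & visible_mx t == visible_mx u].

Fixpoint add_term (n r : nat) (t : wterm n r) (us : seq (wterm n r)) :
    seq (wterm n r) :=
  if us is u :: us' then
    if same_matrix u t
    then WTerm (weight u + weight t) (mat u) (irows u) (icols u) (pivots u)
         :: us'
    else u :: add_term t us'
  else [:: t].

(* Like terms are added up, and those of total weight 0 disappear. Terms with
   the same matrix may come with different pivot items (the order of the pivots
   differs), but the product of these agrees up to sign. *)
Definition collect (n r : nat) (ts : seq (wterm n r)) : seq (wterm n r) :=
  [seq t <- foldl (fun us t => add_term t us) [::] ts | weight t != 0].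

Definition init_term (n r : nat) (B : 'M[int]_(r, n + 1)) : wterm n r :=
  WTerm 1 (col_mx 1%:M (map_mx intr B)) finset.set0 finset.set0 [::].

(* [simpcone_rounds B k ts]: ts is a possible list of terms after k rounds *)
Inductive simpcone_rounds (n r : nat) (B : 'M[int]_(r, n + 1)) :
    nat -> seq (wterm n r) -> Prop :=
| simpcone_start : simpcone_rounds B 0 [:: init_term B]
| simpcone_round k ts us :
    simpcone_rounds B k ts -> expand ts us ->
    simpcone_rounds B k.+1 (collect us).

(* The top rows and the non-ignored columns, in increasing order. After r
   rounds exactly n + 1 - r = d + 1 columns are left, so that the default value
   of [nth] is not reached. *)
Definition final_mx (n r d : nat) (t : wterm n r) : 'M[rat]_(n + 1, d.+1) :=
  \matrix_(a, k) mat t (lshift r a) (nth (rshift n ord0) (enum (~: icols t)%SET) k).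

(* [simpcone B s V p]: the list (s_i, V_i), i < k, is an output of Simpcone
   applied to B, and p i lists the pivot items used in obtaining V_i *)
Definition simpcone (n r d k : nat) (B : 'M[int]_(r, n + 1)) (s : 'I_k -> int)
    (V : 'I_k -> 'M[rat]_(n + 1, d.+1)) (p : 'I_k -> seq rat) : Prop :=
  exists2 ts, simpcone_rounds B r ts &
    [seq (weight t, final_mx d t, pivots t) | t <- ts] =
    [seq (s i, V i, p i) | i <- enum 'I_k].

(* L k is the coefficient of q^k in the Laurent expansion at q = 0 of 1 / f *)
Definition laurent_expansion_inv (f : {poly rat}) (L : int -> rat) : Prop :=
  (exists N : int, forall k : int, k < N -> L k = 0) /\
  (forall k : int,
     \sum_(i < size f) f`_i * L (k - i%:Z) = (k == 0)%:R).

(* CT_q (1 / f) *)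
Definition CTq_inv (f : {poly rat}) : rat :=
  xget 0 [set c | exists2 L, laurent_expansion_inv f L & c = L 0].

(* V = (mu_1, ..., mu_{d+1}), mu_j = (nu_j; m_j) *)
Definition mu_m (n d : nat) (V : 'M[rat]_(n + 1, d.+1)) (j : 'I_d.+1) : rat :=
  dsubmx V 0 j.

Definition beta_nu (n d : nat) (beta : 'cV[int]_n)
    (V : 'M[rat]_(n + 1, d.+1)) (j : 'I_d.+1) : rat :=
  ((map_mx intr beta)^T *m usubmx V) 0 j.

Definition admissible (n d : nat) (beta : 'cV[int]_n)
    (V : 'M[rat]_(n + 1, d.+1)) : Prop :=
  forall j, ~ (beta_nu beta V j = 0 /\ mu_m V j = 0).

Definition Vol_hat (n r d : nat) (D : 'I_r -> int) (p : seq rat)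
    (beta : 'cV[int]_n) (V : 'M[rat]_(n + 1, d.+1)) : rat :=
  `| (\prod_(i < r) D i)%:~R / \prod_(x <- p) x | *
  CTq_inv (\prod_(j < d.+1) ((mu_m V j)%:P - beta_nu beta V j *: 'X)).

(* Main.v *)
Require Import Defs.
From mathcomp Require Import perm ring lra zify.
Set Implicit Arguments.
Unset Strict Implicit.
Unset Printing Implicit Defensive.

(** Let w_{i,j} be integral multiples of the columns of V_i. Multiplying
    sigma_cone = sum_i s_i sigma_{K(V_i)} by Q = prod_{i,j} (1 - y^{w_{i,j}}) turns
    every simplicial term into a Laurent polynomial built from the lattice points
    Pi_i of the fundamental parallelepiped of (w_{i,j})_j. As the cone lies in the
    nonnegative orthant, the common denominator f can be cancelled, so that the
    identity may be evaluated at y^a = t^(N m - beta.nu), a = (nu, m), 0 < t < 1.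
    Multiplying by (1 - t)^(d+1) and letting t -> 1, the right-hand side tends to
    Phi_N = sum_i s_i #Pi_i / prod_j (N m - beta.nu)(w_{i,j}). On the left,
    boundedness of the polytope gives |beta.nu| <= M m on the cone, and comparing
    the lattice counts with binomial coefficients (Abel's theorem) yields
    d! vol / (N + M)^(d+1) <= Phi_N <= d! vol / (N - M)^(d+1). Hence
    N^(d+1) Phi_N -> d! vol; this is the value at q = 1/N of a rational function
    of q, whose limit, being finite, is its constant term at q = 0.

    Finally #Pi_i is a lattice index. The pivots make the bottom of the tableau
    triangular while the column operations have determinant 1, so in Smith
    coordinates this index is |d_1 ... d_r / (p_1 ... p_r)|, up to the scaling of
    the columns, which cancels. *)

(** * Laurent polynomials acting on formal series *)

(** Multiplication of a formal series by the binomial 1 - y^w; [shift_diffs] multiplies by the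
    product of the binomials over [ws]. *)
Definition shift_diff (N : nat) (w : 'cV[int]_N) (F : 'cV[int]_N -> rat) :
    'cV[int]_N -> rat := fun a => F a - F (a - w).

Definition shift_diffs (N : nat) (ws : seq 'cV[int]_N)
    (F : 'cV[int]_N -> rat) := foldr (@shift_diff N) F ws.

Definition finsupp_fun (N : nat) (F : 'cV[int]_N -> rat) :=
  exists X : seq 'cV[int]_N, forall a, F a != 0 -> a \in X.

(** A class of series on which nonzero Laurent polynomials act injectively; it contains the Laurent
    polynomials and the series of cones in the nonnegative orthant. *)
Definition bounded_below_supp (N : nat) (F : 'cV[int]_N -> rat) :=
  exists c : int, forall a, F a != 0 -> forall i, c <= a i 0.

Section ShiftDiff.
Variable N : nat.
Implicit Types (F G f : 'cV[int]_N -> rat) (w : 'cV[int]_N).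

Lemma shift_diffC w v F :
  shift_diff w (shift_diff v F) = shift_diff v (shift_diff w F).
Proof.
apply/funext => a; rewrite /shift_diff.
have -> : a - w - v = a - v - w by rewrite -!addrA [- w - v]addrC.
ring.
Qed.

Lemma shift_diffsC w ws F :
  shift_diffs ws (shift_diff w F) = shift_diff w (shift_diffs ws F).
Proof. by elim: ws => //= v ws ->; rewrite shift_diffC. Qed.

Lemma shift_diffs_cat us vs F :
  shift_diffs (us ++ vs) F = shift_diffs us (shift_diffs vs F).
Proof. by rewrite /shift_diffs foldr_cat. Qed.

Lemma shift_diffs_comm us vs F :
  shift_diffs us (shift_diffs vs F) = shift_diffs vs (shift_diffs us F).
Proof. by elim: us => //= w us ->; rewrite shift_diffsC. Qed.

Lemma shift_diff_finsupp w F : finsupp_fun F -> finsupp_fun (shift_diff w F).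
Proof.
case=> X FX; exists (X ++ [seq x + w | x <- X]) => a Fa; rewrite mem_cat.
have [Fa0|/FX->//] := eqVneq (F a) 0.
apply/orP; right; apply/mapP; exists (a - w); last by rewrite subrK.
by apply: FX; apply: contraNneq Fa => F0; rewrite /shift_diff Fa0 F0 subr0.
Qed.

Lemma shift_diffs_finsupp ws F : finsupp_fun F -> finsupp_fun (shift_diffs ws F).
Proof. by elim: ws => //= w ws IH /IH; apply: shift_diff_finsupp. Qed.

Lemma shift_diff_bounded_below w F :
  bounded_below_supp F -> bounded_below_supp (shift_diff w F).
Proof.
case=> c Fc; pose s := (\sum_i absz (w i 0%R))%N; exists (c - s%:Z) => a Fa i.
have : (absz (w i 0%R) <= s)%N by rewrite /s (bigD1 i) //= leq_addr.
move: s => s wi.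
have [Fa0|/Fc/(_ i)] := eqVneq (F a) 0; last by lia.
have /Fc/(_ i) : F (a - w) != 0.
  by apply: contraNneq Fa => F0; rewrite /shift_diff Fa0 F0 subr0.
by rewrite !mxE; move: (w i 0) (a i 0) wi => x y; lia.
Qed.

Lemma shift_diffs_bounded_below ws F :
  bounded_below_supp F -> bounded_below_supp (shift_diffs ws F).
Proof. by elim: ws => //= w ws IH /IH; apply: shift_diff_bounded_below. Qed.

Lemma finsupp_bounded_below F : finsupp_fun F -> bounded_below_supp F.
Proof.
case=> X FX; exists (- (\sum_(x <- X) \sum_i absz (x i 0%R))%N%:Z) => a /FX aX i.
have : (absz (a i 0%R) <= \sum_(x <- X) \sum_i absz (x i 0%R))%N.
  by rewrite (big_rem a) //= (bigD1 i) //= -addnA leq_addr.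
by lia.
Qed.

Lemma bounded_belowD F G : bounded_below_supp F -> bounded_below_supp G ->
  bounded_below_supp (fun a => F a - G a).
Proof.
move=> [c Fc] [e Ge]; exists (Num.min c e) => a FG i.
have [F0|/Fc/(_ i) h] := eqVneq (F a) 0; last by rewrite ge_min h.
have /Ge/(_ i) h : G a != 0 by apply: contraNneq FG => ->; rewrite F0 subr0.
by rewrite ge_min h orbT.
Qed.

Lemma finsupp_sum (k : nat) (s : 'I_k -> rat) (G : 'I_k -> 'cV[int]_N -> rat) :
  (forall i, finsupp_fun (G i)) ->
  finsupp_fun (fun a => \sum_(i < k) s i * G i a).
Proof.
move=> /choice[X GX]; exists (flatten [seq X i | i <- enum 'I_k]) => a.
move=> h; have /existsP[i Gi] : [exists i, G i a != 0].
  apply: contraNT h; rewrite negb_exists => /forallP G0.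
  by rewrite big1 // => i _; move: (G0 i); rewrite negbK => /eqP ->; rewrite mulr0.
by apply/flattenP; exists (X i); [apply: map_f; rewrite mem_enum|exact: GX].
Qed.

Lemma lmulE f : laurent_poly f -> exists2 X : seq 'cV[int]_N,
  (forall e, (e \in X) = (f e != 0)) &
  uniq X /\ forall F a, lmul f F a = \sum_(e <- X) f e * F (a - e).
Proof.
move=> fin; exists (fset_set [set a | f a != 0]) => [e|].
  by rewrite in_fset_set //; apply/idP/idP => [/set_mem|/mem_set].
by split=> [|F a]; [exact: fset_uniq|rewrite /lmul fsbig_finite].
Qed.

Lemma lmul_shift_diffs f ws F : laurent_poly f ->
  lmul f (shift_diffs ws F) = shift_diffs ws (lmul f F).
Proof.
move=> /lmulE[X _ [_ fE]]; elim: ws => //= w ws <-.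
apply/funext => a; rewrite /shift_diff !fE -sumrB; apply: eq_bigr => e _.
by rewrite mulrBr -!addrA [- w - e]addrC.
Qed.

(* If l v = 0, replacing l by K l + e_i with v_i != 0 and K large repairs v
   without spoiling the vectors already treated. *)
Lemma separating_functional (D : seq 'cV[int]_N) : (forall v, v \in D -> v != 0) ->
  exists l : 'I_N -> int, (forall i, 0 < l i) /\
    forall v, v \in D -> \sum_i l i * v i 0 != 0.
Proof.
elim: D => [_|v D IH Dn0]; first by exists (fun=> 1).
have [|l [lpos lD]] := IH; first by move=> u uD; apply: Dn0; rewrite inE uD orbT.
have [lv|lv] := eqVneq (\sum_i l i * v i 0) 0; last first.
  by exists l; split=> // u; rewrite inE => /predU1P[->//|/lD].
have /existsP[i vi] : [exists i, v i 0 != 0].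
  apply: contraNT (Dn0 v (mem_head _ _)); rewrite negb_exists => /forallP v0.
  by apply/eqP/colP => i; rewrite mxE; move: (v0 i); rewrite negbK => /eqP.
pose K : int := (\sum_(u <- D) absz (u i 0%R)).+1%N%:Z.
have K1 : 1 <= K by [].
exists (fun j => K * l j + (j == i)%:R); split=> [j|u].
  have := lpos j; have : 0 <= (j == i)%:R :> int by rewrite ler0n.
  by nia.
have -> : \sum_j (K * l j + (j == i)%:R) * u j 0 = K * (\sum_j l j * u j 0) + u i 0.
  under eq_bigr do rewrite mulrDl -mulrA.
  rewrite big_split /= -mulr_sumr; congr (_ + _).
  rewrite (bigD1 i) //= eqxx mul1r big1 ?addr0 // => j /negPf->.
  by rewrite mul0r.
rewrite inE => /predU1P[->|uD]; first by rewrite lv mulr0 add0r.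
have uK : ((absz (u i 0%R))%:Z < K)%R.
  by rewrite /K ltz_nat ltnS (big_rem u) //= leq_addr.
have := lD u uD; move: uK K1; set x := u i 0; set y := \sum_j _; move: x y => x y.
by move=> *; nia.
Qed.

(** A positive functional injective on the support of [f] singles out lowest terms e of [f] and a of
    [G]; the coefficient of f G at e + a is then f e * G a alone. The lower bound on the support of
    [G] ensures that its minimum is attained. *)
Lemma lmul_eq0 f G : laurent_poly f -> (exists a, f a != 0) ->
  bounded_below_supp G -> (forall a, lmul f G a = 0) -> forall a, G a = 0.
Proof.
move=> /lmulE[X fX [uX fE]] [a0 fa0] [c Gc] fG0.
(* Not vanishing on these differences means taking distinct values on the support of [f]. *)
pose D := [seq x <- [seq x - y | x <- X, y <- X] | x != 0].
have [|l [lpos lD]] := @separating_functional D.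
  by move=> v; rewrite mem_filter => /andP[].
pose L (a : 'cV[int]_N) : int := \sum_i l i * a i 0.
have LB a b : L (a - b) = L a - L b.
  by rewrite /L -sumrB; apply: eq_bigr => i _; rewrite !mxE mulrBr.
have Linj : {in X &, injective L}.
  move=> x y xX yX Lxy; apply/eqP; rewrite -subr_eq0; apply/negPn/negP => xy.
  have : x - y \in D by rewrite mem_filter xy; apply/allpairsP; exists (x, y).
  by move=> /lD /eqP; apply; rewrite -[LHS]/(L (x - y)) LB Lxy subrr.
have [e eX emin] : exists2 e, e \in X & forall x, x \in X -> L e <= L x.
  have : a0 \in X by rewrite fX.
  have : forall Y : seq 'cV[int]_N, forall a, a \in Y ->
      exists2 e, e \in Y & forall x, x \in Y -> L e <= L x.
    elim=> // y [|z Y] IH a _.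
      by exists y; rewrite ?mem_head // => x; rewrite inE => /eqP->.
    have [e eY he] := IH z (mem_head _ _).
    have [ye|ey] := leP (L y) (L e).
      exists y; rewrite ?mem_head // => x; rewrite inE => /predU1P[->//|/he].
      exact: le_trans.
    exists e; first by rewrite inE eY orbT.
    by move=> x; rewrite inE => /predU1P[->|/he//]; exact: ltW.
  by move=> h /h.
move=> b; apply: contrapT => Gb.
have Lge a : G a <> 0 -> (\sum_i l i * c : int) <= L a.
  move=> /eqP/Gc ca; apply: ler_sum => i _; rewrite ler_wpM2l ?ca //.
  exact: ltW.
pose c0 : int := \sum_i l i * c.
pose h a := absz (L a - c0).
(* As [L] is at least [c0] on the support of [G], its minimum is found by minimizing the natural
   number L a - c0. *)
have [m [a [Ga ham]] mmin] : exists2 m, (exists a, G a <> 0 /\ h a = m) &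
    forall a, G a <> 0 -> (m <= h a)%N.
  have ex : exists m, `[< exists a, G a <> 0 /\ h a = m >].
    by exists (h b); apply/asboolP; exists b.
  case: (ex_minnP ex) => m /asboolP hm mmin; exists m => // a Ga.
  by apply: mmin; apply/asboolP; exists a.
have amin x : G x <> 0 -> L a <= L x.
  move=> Gx; have := mmin _ Gx; rewrite -ham /h.
  by have := Lge _ Gx; have := Lge _ Ga; rewrite -/c0; lia.
have := fG0 (e + a); rewrite fE (big_rem e) //= big1_seq ?addr0.
  rewrite addrAC subrr add0r => /eqP; rewrite mulf_eq0 => /orP[/eqP fe|/eqP//].
  by move: eX; rewrite fX fe eqxx.
move=> x /andP[_]; rewrite rem_filter // mem_filter => /andP[/= xe xX].
apply/eqP; rewrite mulf_eq0; apply/orP; right; apply/negPn/negP => /eqP/amin.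
rewrite LB; have -> : L (e + a) = L e + L a.
  by rewrite /L -big_split; apply: eq_bigr => i _; rewrite !mxE mulrDr.
have := emin x xX; rewrite le_eqVlt => /predU1P[/Linj exx|]; last by lia.
by move: xe; rewrite exx ?eqxx.
Qed.

(** The product of all the binomials turns each [G i] into a Laurent polynomial [E' i]. Both sides
    then have support bounded below, and the common denominator [f] is cancelled by [lmul_eq0]. *)
Lemma ratfun_eq_sum_shift_diffs (k : nat) F (s : 'I_k -> int)
    (G E : 'I_k -> 'cV[int]_N -> rat) (ws : 'I_k -> seq 'cV[int]_N) :
  ratfun_eq_sum F s G -> bounded_below_supp F ->
  (forall i, finsupp_fun (E i)) -> (forall i, shift_diffs (ws i) (G i) = E i) ->
  let us := flatten [seq ws i | i <- enum 'I_k] in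
  exists E' : 'I_k -> 'cV[int]_N -> rat,
  [/\ forall i, finsupp_fun (E' i),
      forall i, shift_diffs (ws i) (E' i) = shift_diffs us (E i) &
      forall a, shift_diffs us F a = \sum_(i < k) (s i)%:~R * E' i a].
Proof.
move=> [f [flp f0 _ _ fFG]] Fb Efs GE us.
pose E' i := shift_diffs us (G i).
have E'fs i : finsupp_fun (E' i).
  have : i \in enum 'I_k by rewrite mem_enum.
  rewrite /E' /us; case/splitPr => s1 s2; rewrite map_cat flatten_cat /=.
  rewrite !shift_diffs_cat [shift_diffs (ws i) _]shift_diffs_comm GE.
  by do 2!apply: shift_diffs_finsupp.
exists E'; split=> // [i|a]; first by rewrite /E' shift_diffs_comm GE.
apply/eqP; rewrite -subr_eq0; apply/eqP; move: a.
apply: (lmul_eq0 flp f0).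
  apply: bounded_belowD; first exact: shift_diffs_bounded_below.
  exact/finsupp_bounded_below/finsupp_sum.
move=> a; have [X _ [_ fE]] := lmulE flp.
have -> : lmul f (fun a => shift_diffs us F a - \sum_(i < k) (s i)%:~R * E' i a) a
  = lmul f (shift_diffs us F) a - \sum_(i < k) (s i)%:~R * lmul f (E' i) a.
  rewrite !fE; under [X in _ = _ - X]eq_bigr do rewrite fE mulr_sumr.
  rewrite exchange_big /= -sumrB; apply: eq_bigr => e _.
  rewrite mulrBr mulr_sumr; congr (_ - _); apply: eq_bigr => i _; ring.
rewrite lmul_shift_diffs //.
under eq_bigr do rewrite /E' lmul_shift_diffs //.
have -> : lmul f F = fun a => \sum_(i < k) (s i)%:~R * lmul f (G i) a.
  exact/funext.
elim: us a {E' E'fs} => [|w us IH] a /=; first by rewrite subrr.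
rewrite /shift_diff; move: (IH a) (IH (a - w)).
under [X in _ -> _ -> _ - X = _]eq_bigr do rewrite mulrBr.
rewrite sumrB => /eqP; rewrite subr_eq0 => /eqP-> /eqP; rewrite subr_eq0 => /eqP->.
by rewrite subrr.
Qed.

End ShiftDiff.

(** * Unconditional sums and characters *)

(** Convergence along the net of finite subsets of [T]: no enumeration of the lattice has to be
    chosen, and translating the index preserves the sum. *)
Definition has_usum (R : realType) (T : choiceType) (F : T -> R) (S : R) :=
  forall e : R, 0 < e -> exists X0 : {fset T}, forall X : {fset T},
    (X0 `<=` X)%fset -> `|\sum_(a <- X) F a - S| < e.

Section UnconditionalSums.
Variables (R : realType) (T : choiceType).
Implicit Types (F G : T -> R) (S : R).

Lemma has_usumD F G S S' : has_usum F S -> has_usum G S' ->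
  has_usum (fun a => F a + G a) (S + S').
Proof.
move=> FS GS e e0; have e2 : 0 < e / 2 by rewrite divr_gt0.
have [X XF] := FS _ e2; have [Y YG] := GS _ e2.
exists (X `|` Y)%fset => Z; rewrite fsubUset => /andP[/XF h1 /YG h2].
rewrite big_split /= opprD addrACA (splitr e).
by apply: le_lt_trans (ler_normD _ _) _; exact: ltrD.
Qed.

Lemma has_usumZ F S c : has_usum F S -> has_usum (fun a => c * F a) (c * S).
Proof.
move=> FS e e0.
have e2 : 0 < e / (`|c| + 1) by rewrite divr_gt0 // ltr_wpDl.
have [X XF] := FS _ e2; exists X => Z /XF h.
rewrite -mulr_sumr -mulrBr normrM.
have c1 : 0 < `|c| + 1 by rewrite ltr_wpDl.
move: h; rewrite ltr_pdivlMr // => h; apply: le_lt_trans h.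
by rewrite mulrC ler_wpM2l // lerDl.
Qed.

Lemma has_usum_unique F S S' : has_usum F S -> has_usum F S' -> S = S'.
Proof.
move=> FS FS'; apply/eqP; rewrite -subr_eq0 -normr_le0 leNgt; apply/negP => e0.
have e2 : 0 < `|S - S'| / 2 by rewrite divr_gt0.
have [X XF] := FS _ e2; have [Y YF] := FS' _ e2.
have h1 := XF _ (fsubsetUl X Y); have h2 := YF _ (fsubsetUr X Y).
suff : `|S - S'| < `|S - S'| by rewrite ltxx.
rewrite [Q in _ < Q]splitr; apply: le_lt_trans (ltrD h1 h2).
rewrite -[Q in _ <= Q + _]normrN; apply: le_trans (ler_normD _ _).
by rewrite opprB addrA subrK.
Qed.

Lemma has_usum_finite F (X : seq T) : uniq X ->
  (forall a, a \notin X -> F a = 0) -> has_usum F (\sum_(a <- X) F a).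
Proof.
move=> uX FX e e0; exists [fset x in X]%fset => Z XZ.
rewrite (bigID (mem X)) /= [Q in _ + Q - _]big1 => [|a /FX //]; rewrite addr0.
rewrite -big_filter (perm_big X) /= ?subrr ?normr0 //.
apply: uniq_perm => // [|x]; first by rewrite filter_uniq ?fset_uniq.
rewrite mem_filter /=; case xX: (x \in X) => //=.
by apply: (fsubsetP XZ); rewrite inE.
Qed.

Lemma ler_sum_subset F (Y Z : seq T) : (forall a, 0 <= F a) -> uniq Y -> uniq Z ->
  {subset Y <= Z} -> \sum_(a <- Y) F a <= \sum_(a <- Z) F a.
Proof.
move=> F0 uY uZ YZ; rewrite [leRHS](bigID (mem Y)) /= -[leLHS]addr0.
rewrite lerD ?sumr_ge0 // -[leRHS]big_filter.
suff /(perm_big _)-> : perm_eq [seq i <- Z | i \in Y] Y by [].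
apply: uniq_perm => [| |x]; rewrite ?filter_uniq // mem_filter /=.
by apply/andb_idr => /YZ.
Qed.

Lemma has_usum_nonneg F (B : R) : (forall a, 0 <= F a) ->
  (forall X : {fset T}, \sum_(a <- X) F a <= B) -> exists S, has_usum F S.
Proof.
move=> F0 FB; pose A := [set \sum_(a <- X) F a | X in [set: {fset T}]].
have supA : has_sup A.
  split; first by exists (\sum_(a <- fset0) F a), fset0.
  by exists B => _ [X _ <-].
exists (sup A) => e e0.
have [_ [X0 _ <-] hX0] := sup_adherent e0 supA; exists X0 => X X0X.
have h1 : \sum_(a <- X) F a <= sup A by apply: ub_le_sup; [exact: supA.2|exists X].
have h2 : \sum_(a <- X0) F a <= \sum_(a <- X) F a.
  by apply: ler_sum_subset; rewrite ?fset_uniq //; exact/fsubsetP.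
by rewrite ler0_norm ?subr_le0 // opprB ltrBlDr -ltrBlDl (lt_le_trans hX0).
Qed.

Lemma has_usum_le F S (B : R) : has_usum F S ->
  (forall X : {fset T}, \sum_(a <- X) F a <= B) -> S <= B.
Proof.
move=> FS FB; rewrite leNgt; apply/negP; rewrite -subr_gt0 => /FS[X /(_ X)].
move=> /(_ (fsubset_refl _)); rewrite ltr_norml => /andP[+ _].
by have := FB X; lra.
Qed.

Lemma has_usum_ge F S (Y : seq T) : has_usum F S -> (forall a, 0 <= F a) ->
  uniq Y -> \sum_(a <- Y) F a <= S.
Proof.
move=> FS F0 uY; rewrite leNgt; apply/negP; rewrite -subr_gt0 => /FS[X XS].
pose Z := (X `|` [fset y in Y])%fset.
have := XS Z (fsubsetUl _ _).
have : \sum_(a <- Y) F a <= \sum_(a <- Z) F a.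
  apply: ler_sum_subset; rewrite ?fset_uniq // => x xY.
  by rewrite in_fsetU inE /= xY orbT.
by rewrite ltr_norml => h /andP[_]; lra.
Qed.

End UnconditionalSums.

Lemma has_usum_shift (R : realType) (T : zmodType) (F : T -> R) S w :
  has_usum F S -> has_usum (fun a => F (a - w)) S.
Proof.
move=> FS e /FS[X XF]; exists [fset (x + w)%R | x in X]%fset => Z XZ.
have -> : \sum_(a <- Z) F (a - w) = \sum_(a <- [fset (z - w)%R | z in Z]%fset) F a.
  rewrite big_imfset //= => x y _ _; exact: addIr.
apply: XF; apply/fsubsetP => x xX; apply/imfsetP; exists (x + w); rewrite ?addrK //=.
by apply: (fsubsetP XZ); apply/imfsetP; exists x.
Qed.

Section Characters.
Variables (R : realType) (N : nat) (chi : 'cV[int]_N -> R).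
Hypothesis chiD : forall a b, chi (a + b) = chi a * chi b.

(** The value of the series at a point where y^a takes the value [chi a], convergence being
    unconditional. *)
Definition has_eval (F : 'cV[int]_N -> rat) (S : R) :=
  has_usum (fun a => ratr (F a) * chi a) S.

Lemma has_eval_shift_diff w F S :
  has_eval F S -> has_eval (shift_diff w F) ((1 - chi w) * S).
Proof.
move=> FS; have := has_usumD FS (has_usumZ (- chi w) (has_usum_shift w FS)).
rewrite mulNr mulrBl mul1r; set G := fun a => _.
suff -> : G = fun a => ratr (shift_diff w F a) * chi a by [].
apply/funext => a; rewrite /G /shift_diff rmorphB /= mulrBl.
have -> : chi a = chi (a - w) * chi w by rewrite -chiD subrK.
ring.
Qed.

Lemma has_eval_shift_diffs ws F S : has_eval F S ->
  has_eval (shift_diffs ws F) ((\prod_(w <- ws) (1 - chi w)) * S).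
Proof.
move=> FS; elim: ws => [|w ws IH] /=; first by rewrite big_nil mul1r.
by rewrite big_cons -mulrA; exact: has_eval_shift_diff.
Qed.

Lemma has_eval_finsupp F : finsupp_fun F -> exists S, has_eval F S.
Proof.
case=> X FX; exists (\sum_(a <- undup X) ratr (F a) * chi a).
apply: has_usum_finite; first exact: undup_uniq.
move=> a; rewrite mem_undup => aX.
suff -> : F a = 0 by rewrite rmorph0 mul0r.
by apply/eqP; apply: contraNT aX => /FX.
Qed.

(** The [G i] need not converge at [chi]; on the right only Laurent polynomials are evaluated.
    Evaluating the product of all binomials with [E i] in two ways gives the value of [E' i], and
    the product, nonzero at [chi], cancels. *)
Lemma eval_ratfun_eq_sum (k : nat) F (s : 'I_k -> int)
    (G E : 'I_k -> 'cV[int]_N -> rat) (ws : 'I_k -> seq 'cV[int]_N) S (P : 'I_k -> R) :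
  ratfun_eq_sum F s G -> bounded_below_supp F ->
  (forall i, finsupp_fun (E i)) -> (forall i, shift_diffs (ws i) (G i) = E i) ->
  (forall i w, w \in ws i -> chi w != 1) ->
  has_eval F S -> (forall i, has_eval (E i) (P i)) ->
  S = \sum_(i < k) (s i)%:~R * (P i / \prod_(w <- ws i) (1 - chi w)).
Proof.
move=> FG Fb Efs GE chi1 FS EP.
have [E' [E'fs EE' FE']] := ratfun_eq_sum_shift_diffs FG Fb Efs GE.
set us := flatten _ in EE' FE'.
have us0 : \prod_(w <- us) (1 - chi w) != 0.
  rewrite prodf_seq_neq0; apply/allP => w /flattenP[? /mapP[i _ ->]] /chi1.
  by rewrite subr_eq0 eq_sym.
have ws0 i : \prod_(w <- ws i) (1 - chi w) != 0.
  rewrite prodf_seq_neq0; apply/allP => w /chi1.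
  by rewrite subr_eq0 eq_sym.
have [P' E'P] := choice (fun i => has_eval_finsupp (E'fs i)).
have P'E i : P' i = (\prod_(w <- us) (1 - chi w)) * (P i / \prod_(w <- ws i) (1 - chi w)).
  have h1 := has_eval_shift_diffs (ws i) (E'P i).
  have := has_eval_shift_diffs us (EP i); rewrite -EE' => /(has_usum_unique h1) h.
  by rewrite mulrA -h mulrAC divff // mul1r.
apply: (mulfI us0).
have h1 := has_eval_shift_diffs us FS.
rewrite mulr_sumr; under [RHS]eq_bigr do rewrite mulrCA -P'E.
apply: has_usum_unique h1 _.
have -> : (fun a => ratr (shift_diffs us F a) * chi a) =
    fun a => \sum_(i <- enum 'I_k) (s i)%:~R * (ratr (E' i a) * chi a).
  apply/funext => a; rewrite FE' rmorph_sum mulr_suml /= big_enum /=.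
  by apply: eq_bigr => i _; rewrite rmorphM /= ratr_int -[LHS]mulrA.
rewrite -big_enum /=; elim: (enum _) => [|i l IH].
  rewrite big_nil; have := @has_usum_finite R _ (fun=> 0) (@nil 'cV[int]_N) isT (fun _ _ => erefl).
  by rewrite big_nil => h; under eq_fun do rewrite big_nil.
rewrite big_cons; under eq_fun do rewrite big_cons.
exact: has_usumD (has_usumZ _ (E'P i)) IH.
Qed.

End Characters.

(** * Simplicial cones *)

Section HalfOpenCones.
Variables (R : realType) (N e : nat) (W : 'M[int]_(N, e)).
Let WR : 'M[R]_(N, e) := map_mx intr W.

(** This interpolates between the simplicial cone, for [J] empty, and the half-open fundamental
    parallelepiped, when [J] contains every index. *)
Definition half_open (J : seq 'I_e) (z : 'cV[int]_N) : Prop :=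
  exists x : 'cV[R]_e, [/\ forall j, 0 <= x j 0,
    forall j, j \in J -> x j 0 < 1 & map_mx intr z = WR *m x].

Definition half_open_series (J : seq 'I_e) : 'cV[int]_N -> rat :=
  fun z => (`[< half_open J z >])%:R.

Hypothesis fullW : row_full WR.

Lemma mulW_inj : injective (fun x : 'cV[R]_e => WR *m x).
Proof.
have /row_fullP[B BW] := fullW.
by move=> x y /(congr1 (mulmx B)); rewrite !mulmxA BW !mul1mx.
Qed.

(** Coordinates in independent columns are unique, so subtracting the translate by column [j]
    removes exactly the points whose [j]-th coordinate is at least 1. *)
Lemma shift_diff_half_open j J : j \notin J ->
  shift_diff (col j W) (half_open_series J) = half_open_series (j :: J).
Proof.
move=> jJ; apply/funext => a; rewrite /shift_diff /half_open_series.
pose d : 'cV[R]_e := \col_i (i == j)%:R.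
have Wd : WR *m d = map_mx intr (col j W).
  apply/colP => i; rewrite !mxE (bigD1 j) //= big1 => [|i' /negPf ij].
    by rewrite !mxE eqxx mulr1 addr0.
  by rewrite !mxE ij mulr0.
have [[x [x0 x1 ax]]|aJ] := pselect (half_open J a); last first.
  rewrite !asboolF ?subr0 //.
  - by move=> [x [x0 x1 ax]]; apply: aJ; exists x; split=> // i iJ; rewrite x1 // inE iJ orbT.
  - move=> [x [x0 x1 ax]]; apply: aJ; exists (x + d); split.
    + by move=> i; rewrite !mxE addr_ge0.
    + move=> i iJ; rewrite !mxE; case: eqVneq => [ij|_]; last by rewrite addr0 x1.
      by move: jJ; rewrite -ij iJ.
    + by rewrite mulmxDr Wd -ax map_mxB subrK.
rewrite asboolT; last by exists x.
have [xj|xj] := ltP (x j 0) 1.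
  rewrite asboolF; last first.
    move=> [y [y0 y1 ay]]; move: (y0 j).
    have -> : y = x - d.
      by apply: mulW_inj; rewrite mulmxBr Wd -ax -ay map_mxB.
    by rewrite !mxE eqxx subr_ge0 leNgt xj.
  rewrite asboolT ?subr0 //; exists x; split=> // i.
  by rewrite inE => /predU1P[->|/x1].
rewrite asboolT; last first.
  exists (x - d); split.
  - move=> i; rewrite !mxE; case: eqVneq => [->|_]; first by rewrite subr_ge0.
    by rewrite subr0.
  - move=> i iJ; rewrite !mxE; case: eqVneq => [ij|_]; last by rewrite subr0 x1.
    by move: jJ; rewrite -ij iJ.
  - by rewrite mulmxBr Wd -ax map_mxB.
rewrite asboolF ?subrr // => -[y [y0 y1 ay]].
have yx : y = x by apply: mulW_inj; rewrite -ay -ax.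
by move: (y1 j (mem_head _ _)); rewrite yx ltNge xj.
Qed.

Lemma shift_diffs_half_open J : uniq J ->
  shift_diffs [seq col j W | j <- J] (half_open_series [::]) = half_open_series J.
Proof. by elim: J => //= j J IH /andP[jJ uJ]; rewrite IH // shift_diff_half_open. Qed.

End HalfOpenCones.

Lemma common_denominator (N e : nat) (V : 'M[rat]_(N, e)) :
  exists (c : int) (W : 'M[int]_(N, e)), 0 < c /\ map_mx intr W = c%:~R *: V.
Proof.
pose c : int := \prod_i \prod_j denq (V i j).
exists c, (\matrix_(i, j) numq (c%:~R * V i j)); split.
  by rewrite prodr_gt0 // => i _; rewrite prodr_gt0 // => j _; exact: denq_gt0.
apply/matrixP => i j; rewrite !mxE.
suff /intrP[m ->] : c%:~R * V i j \is a Num.int by rewrite numq_int.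
pose q i' j' : int := denq (V i' j').
have -> : c%:~R * V i j = ((\prod_(i' | i' != i) \prod_j' q i' j') *
    (\prod_(j' | j' != j) q i j') * numq (V i j))%:~R.
  by rewrite /c (bigD1 i) //= [\prod_j' _](bigD1 j) //= !intrM numqE; ring.
exact: intr_int.
Qed.

Section SimplicialCone.
Variables (R : realType) (N e : nat) (V : 'M[rat]_(N, e)) (c : int) (W : 'M[int]_(N, e)).
Hypotheses (c0 : 0 < c) (WV : map_mx intr W = c%:~R *: V) (rV : \rank V = e).

Lemma map_intr_scale : map_mx intr W = c%:~R *: map_mx ratr V :> 'M[R]_(N, e).
Proof.
rewrite -[c%:~R](ratr_int R) -map_mxZ -WV -map_mx_comp.
by apply: eq_map_mx => x /=; rewrite ratr_int.
Qed.

Lemma row_full_intr : row_full (map_mx intr W : 'M[R]_(N, e)).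
Proof.
have cR : c%:~R != 0 :> R by rewrite intr_eq0 gt_eqF.
rewrite /row_full map_intr_scale (mxrank_scale_nz _ cR).
by apply/eqP; apply: etrans rV; exact: mxrank_map.
Qed.

Lemma sigma_cone_genE : sigma (cone_gen R V) = half_open_series R W [::].
Proof.
have cR : 0 < c%:~R :> R by rewrite ltr0z.
apply/funext => a; rewrite /sigma /half_open_series; congr (_%:R); congr (nat_of_bool _).
apply/asbool_equiv_eq; split.
  move=> [x [x0 ax]]; exists (c%:~R^-1 *: x); split=> //.
    by move=> j; rewrite mxE mulr_ge0 // invr_ge0 ltW.
  by rewrite map_intr_scale -scalemxAr -scalemxAl scalerA mulVf ?scale1r // gt_eqF.
move=> [x [x0 _ ax]]; exists (c%:~R *: x); split=> //.
  by move=> j; rewrite mxE mulr_ge0 // ltW.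
by rewrite ax map_intr_scale -scalemxAr -scalemxAl.
Qed.

End SimplicialCone.

(** * Lattice points of parallelepipeds *)

Lemma absz_det_unit (m : nat) (U : 'M[int]_m) : U \in unitmx -> absz (\det U) = 1%N.
Proof.
rewrite unitmxE => /mulVr/(congr1 absz); rewrite abszM => /eqP.
by rewrite muln_eq1 => /andP[_ /eqP].
Qed.

Lemma ltn_congr_eq (a m : int) (p q : nat) : (p < absz a)%N -> (q < absz a)%N ->
  p%:Z - q%:Z = a * m -> p = q.
Proof.
move=> pa qa h; have [m0|m0] := eqVneq m 0.
  by move: h; rewrite m0 mulr0 => /eqP; rewrite subr_eq0 => /eqP[].
have : (absz a <= absz (p%:Z - q%:Z))%N by rewrite h abszM leq_pmulr // absz_gt0.
by lia.
Qed.

Section ParallelepipedCount.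
Variables (R : realType) (e : nat) (W : 'M[int]_e).
Hypothesis detW : \det W != 0.
Let WR : 'M[R]_e := map_mx intr W.

Let unitWR : WR \in unitmx.
Proof. by rewrite unitmxE unitfE det_map_mx intr_eq0. Qed.

Let box (z : 'cV[int]_e) : Prop :=
  exists x : 'cV[R]_e, (forall j, 0 <= x j 0 < 1) /\ map_mx intr z = WR *m x.

(** The representative of [z] modulo the column lattice of [W] inside the half-open parallelepiped:
    coordinates are replaced by their fractional parts. *)
Let red (z : 'cV[int]_e) : 'cV[int]_e :=
  z - W *m \col_j Num.floor ((invmx WR *m map_mx intr z) j 0).

Let red_box z : box (red z).
Proof.
rewrite /red; have [x xE] : exists x, x = invmx WR *m map_mx intr z by eexists.
rewrite -xE; exists (x - map_mx intr (\col_j Num.floor (x j 0))); split=> [j|].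
  rewrite !mxE; have := floor_itv (x j 0); rewrite intrD rmorph1. lra.
by rewrite map_mxB map_mxM mulmxBr xE mulKVmx.
Qed.

Let red_congr z m : box z -> red (z + W *m m) = z.
Proof.
move=> [x [x01 zx]]; rewrite /red.
suff -> : \col_j Num.floor ((invmx WR *m map_mx intr (z + W *m m)) j 0) = m.
  by rewrite addrK.
apply/colP => j; rewrite mxE map_mxD map_mxM zx -/WR -mulmxDr mulKmx // !mxE.
apply/floor_def; move: (x01 j); rewrite intrD rmorph1; lra.
Qed.

(** The points of the parallelepiped represent the classes of Z^e modulo [W]. The Smith form of [W]
    identifies this quotient with a product of cyclic groups of orders |dl_i|. *)
Lemma parallelepiped_count : exists X : seq 'cV[int]_e,
  [/\ uniq X, forall z, z \in X <-> (exists x : 'cV[R]_e,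
        (forall j, 0 <= x j 0 < 1) /\ map_mx intr z = map_mx intr W *m x) &
      size X = absz (\det W)].
Proof.
have [L uL [Q uQ [ds _ WE]]] := int_Smith_normal_form W.
pose dl (i : 'I_e) := ds`_i.
pose Dm := diag_mx (\row_i dl i).
have {}WE : W = L *m Dm *m Q.
  rewrite WE; congr (_ *m _ *m _); apply/matrixP => i j; rewrite !mxE.
  by rewrite val_eqE; case: eqP => [->|].
have detE : absz (\det W) = (\prod_i absz (dl i))%N.
  rewrite WE !det_mulmx !abszM (absz_det_unit uL) (absz_det_unit uQ) mul1n muln1 det_diag.
  rewrite (big_morph absz abszM (erefl _)); apply: eq_bigr => i _.
  by rewrite mxE.
have dl0 i : dl i != 0.
  have : absz (\det W) != 0%N by rewrite absz_eq0.
  by apply: contra => /eqP di; rewrite detE (bigD1 i) //= di.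
pose Y := {dffun forall i : 'I_e, 'I_(absz (dl i))}.
pose emb (y : Y) : 'cV[int]_e := \col_i (y i : nat)%:Z.
pose F (y : Y) := red (L *m emb y).
have Finj : injective F.
  move=> y y' Fy; apply/ffunP => i; apply/val_inj => /=.
  (* Equal reductions mean congruence modulo W = L Dm Q; removing the invertible [L] gives
     congruence of the residue vectors modulo [Dm]. *)
  have [k yk] : exists k, emb y - emb y' = Dm *m k.
    move: Fy; rewrite /F /red; move: (\col_j _) (\col_j _) => f f' Fy.
    exists (Q *m (f' - f)).
    apply: (can_inj (mulKmx uL)); rewrite mulmxBr !mulmxA -WE mulmxBr.
    move: Fy; move: (L *m _) (L *m _) (W *m _) (W *m _) => a a' b b'.
    move=> /eqP; rewrite subr_eq => /eqP->.
    by rewrite addrAC [Z in Z + _]addrAC subrr add0r addrC.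
  have := congr1 (fun M : 'cV[int]_e => M i 0) yk.
  rewrite /Dm mul_diag_mx !mxE.
  exact: ltn_congr_eq.
exists [seq F y | y <- enum Y]; split.
- by rewrite map_inj_uniq // enum_uniq.
- move=> z; split; first by move=> /mapP[y _ ->]; exact: red_box.
  (* A preimage is found by reducing the coordinates of L^-1 z modulo the [dl i]. *)
  move=> zbox; have [x Lx] : exists x, x = invmx L *m z by eexists.
  have yP i : (absz (x i 0%R %% dl i)%Z < absz (dl i))%N.
    have := modz_ge0 (x i 0) (dl0 i); have := ltz_mod (x i 0) (dl0 i).
    by lia.
  pose y : Y := [ffun i => Ordinal (yP i)].
  apply/mapP; exists y; first by rewrite mem_enum.
  have xE : x = emb y + Dm *m \col_i (x i 0%R %/ dl i)%Z.
    apply/colP => i; rewrite /Dm mul_diag_mx !mxE ffunE /= gez0_abs ?modz_ge0 //.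
    by rewrite {1}(divz_eq (x i 0) (dl i)) addrC mulrC.
  rewrite /F; have -> : L *m emb y = z + W *m - (invmx Q *m \col_i (x i 0%R %/ dl i)%Z).
    have zE : z = L *m x by rewrite Lx mulKVmx.
    by rewrite mulmxN WE -!mulmxA mulKVmx // {1}zE -mulmxBr {1}xE addrK.
  by rewrite red_congr.
- rewrite size_map -cardE card_dep_ffun detE foldrE big_map.
  by rewrite big_enum; apply: eq_bigr => i _; rewrite card_ord.
Qed.

End ParallelepipedCount.

Lemma norm_det_rowsub (F : numDomainType) (m : nat) (h : 'I_m -> 'I_m) (M : 'M[F]_m) :
  injective h -> `|\det (rowsub h M)| = `|\det M|.
Proof.
move=> hi; have -> : rowsub h M = row_perm (perm hi) M.
  by apply/matrixP => i j; rewrite !mxE permE.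
by rewrite row_permE det_mulmx det_perm normrM normrX normrN1 expr1n mul1r.
Qed.

Lemma norm_det_colsub (F : numDomainType) (m : nat) (h : 'I_m -> 'I_m) (M : 'M[F]_m) :
  injective h -> `|\det (colsub h M)| = `|\det M|.
Proof.
move=> hi; rewrite -det_tr -[in RHS]det_tr -(norm_det_rowsub M^T hi).
by congr (`|\det _|); apply/matrixP => i j; rewrite !mxE.
Qed.

Lemma map_mx_intr_inj (F : numDomainType) (m p : nat) :
  injective (map_mx intr : 'M[int]_(m, p) -> 'M[F]_(m, p)).
Proof.
by move=> M M' /matrixP h; apply/matrixP => i j; have := h i j; rewrite !mxE => /intr_inj.
Qed.

(** * The parallelepiped of a simplicial cone as a lattice index *)

Section SmithParallelepiped.
Variables (R : realType) (r e : nat) (B : 'M[int]_(r, r + e)) (D : 'I_r -> int).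
Variables (T : 'M[rat]_(r + e)) (TJ : 'M[rat]_(r + e, r)) (V : 'M[rat]_(r + e, e)).
Variables (h : 'I_(r + e) -> 'I_(r + e)) (q : rat) (c : int) (W : 'M[int]_(r + e, e)).
Hypotheses (hD : smith_normal_form B D) (detT : `|\det T| = 1) (hinj : injective h).
Hypotheses (TE : row_mx TJ V = colsub h T) (BV : map_mx intr B *m V = 0).
Hypotheses (detBT : `|\det (map_mx intr B *m TJ)| = `|q|) (q0 : q != 0).
Hypotheses (c0 : 0 < c) (WV : map_mx intr W = c%:~R *: V).

(* In Smith coordinates U^-1, the matrix (TJ, V) of determinant +-1 is block
   triangular: its diagonal blocks have determinants +-q / prod D (this is
   B TJ up to L and D) and that of V. *)
Lemma smith_parallelepiped : exists X : seq 'cV[int]_(r + e),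
  [/\ uniq X, forall z, z \in X <-> half_open R W (enum 'I_e) z &
      (size X)%:R = c%:~R ^+ e * `|(\prod_i D i)%:~R / q| :> rat].
Proof.
have [_ [L [U [uL uU LBU]]]] := hD.
pose Dm : 'M[int]_r := diag_mx (\row_i D i).
pose Ui := invmx U.
have SE : \matrix_(i < r, j < r + e) (D i *+ (i == j :> nat)) = row_mx Dm 0.
  apply/matrixP => i j; rewrite !mxE; case: splitP => j' ->.
    by rewrite !mxE val_eqE; case: eqP => [->|].
  by rewrite mxE (ltn_eqF (leq_trans (ltn_ord i) (leq_addr _ _))).
have LB : L *m B = row_mx Dm 0 *m Ui by rewrite -SE -LBU mulmxK.
pose toQ m p (M : 'M[int]_(m, p)) : 'M[rat]_(m, p) := map_mx intr M.
have LBq : toQ _ _ L *m toQ _ _ B = row_mx (toQ _ _ Dm) 0 *m toQ _ _ Ui.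
  by rewrite /toQ -map_mxM LB map_mxM map_row_mx map_mx0.
have det1 m (M : 'M[int]_m) : M \in unitmx -> `|\det (toQ _ _ M)| = 1.
  move=> /absz_det_unit h1; rewrite det_map_mx.
  by rewrite -intr_norm -abszE h1.
pose X := usubmx (toQ _ _ Ui *m TJ); pose V' := dsubmx (toQ _ _ Ui *m V).
(* Up to the invertible [L], the map [B] reads only the first [r] Smith coordinates and scales them
   by the invariants. *)
have LBP p (M : 'M[rat]_(r + e, p)) :
    toQ _ _ L *m (toQ _ _ B *m M) = toQ _ _ Dm *m usubmx (toQ _ _ Ui *m M).
  rewrite mulmxA LBq -mulmxA -{1}[toQ _ _ Ui *m M]vsubmxK mul_row_col mul0mx addr0 //.
have DX : `|\det (toQ _ _ Dm)| * `|\det X| = `|q|.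
  by rewrite -normrM -det_mulmx -LBP det_mulmx normrM det1 // mul1r detBT.
have Dm0 : \det (toQ _ _ Dm) != 0.
  apply: contraNneq q0 => D0; move: DX; rewrite D0 normr0 mul0r => /esym/eqP.
  by rewrite normr_eq0.
(* The columns of [V] are in the kernel of [B], so their first [r] Smith coordinates vanish. *)
have V0 : usubmx (toQ _ _ Ui *m V) = 0.
  have uD : toQ _ _ Dm \in unitmx by rewrite unitmxE unitfE.
  apply: (can_inj (mulKmx uD)).
  by rewrite -LBP BV !mulmx0.
have XV : `|\det X| * `|\det V'| = 1.
  rewrite -normrM -(det_lblock X (dsubmx (toQ _ _ Ui *m TJ)) V').
  have -> : block_mx X 0 (dsubmx (toQ _ _ Ui *m TJ)) V' = toQ _ _ Ui *m row_mx TJ V.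
    by rewrite block_mxEh mul_mx_row; congr row_mx; rewrite -?V0 vsubmxK.
  rewrite TE det_mulmx normrM norm_det_colsub // detT mulr1 det1 //.
  by rewrite unitmx_inv.
have detV' : `|\det V'| = `|(\prod_i D i)%:~R / q|.
  have -> : (\prod_i D i)%:~R = \det (toQ _ _ Dm).
    rewrite det_map_mx det_diag; congr (_%:~R); apply: eq_bigr => i _.
    by rewrite mxE.
  have X0 : `|\det X| != 0 by apply: contra_eq_neq XV => ->; rewrite mul0r eq_sym oner_eq0.
  rewrite normrM normfV -DX invfM mulrA mulfV ?normr_eq0 // mul1r.
  by apply: (mulfI X0); rewrite XV divff.
(* The columns of [W] in a basis of the lattice of integral points of the kernel of [B]; the index
   sought is |det W'|. *)
pose W' := dsubmx (Ui *m W).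
have WQ : map_mx intr (Ui *m W) = c%:~R *: (toQ _ _ Ui *m V).
  by rewrite map_mxM WV scalemxAr.
have W'V : toQ _ _ W' = c%:~R *: V'.
  by rewrite /toQ /W' map_dsubmx WQ linearZ.
have WE : W = U *m col_mx 0 W'.
  have -> : col_mx 0 W' = Ui *m W.
    rewrite -[RHS]vsubmxK; congr (col_mx _ _); apply: (@map_mx_intr_inj rat).
    by rewrite map_usubmx WQ linearZ /= V0 scaler0 map_mx0.
  by rewrite mulKVmx.
have cQ : 0 < c%:~R :> rat by rewrite ltr0z.
have detW' : (absz (\det W'))%:R = c%:~R ^+ e * `|\det V'| :> rat.
  have -> : (absz (\det W'))%:R = `|\det (toQ _ _ W')| :> rat.
    by rewrite det_map_mx -intr_norm -abszE.
  by rewrite W'V detZ normrM ger0_norm // exprn_ge0 // ltW.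
have W'0 : \det W' != 0.
  have V'0 : `|\det V'| != 0 by apply: contra_eq_neq XV => ->; rewrite mulr0 eq_sym oner_eq0.
  by rewrite -absz_eq0 -(eqr_nat rat) detW' mulf_neq0 // expf_neq0 // gt_eqF.
have [X' [uX' X'P sX']] := parallelepiped_count R W'0.
exists [seq U *m col_mx 0 z | z <- X']; split.
- rewrite map_inj_uniq // => z z' /(can_inj (mulKmx uU)) /eq_col_mx[_]; exact.
- have UW (x : 'cV[R]_e) : map_mx intr W *m x =
      map_mx intr U *m col_mx 0 (map_mx intr W' *m x).
    by rewrite WE map_mxM map_col_mx map_mx0 -mulmxA mul_col_mx mul0mx.
  have Uinj : injective (mulmx (map_mx intr U : 'M[R]_(r + e)) : 'cV[R]_(r + e) -> 'cV[R]_(r + e)).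
    move=> x y /(congr1 (mulmx (map_mx intr Ui))); rewrite !mulmxA -map_mxM.
    by rewrite mulVmx // map_mx1 !mul1mx.
  move=> z; split.
    move=> /mapP[z' /X'P[x [x01 z'x]] ->]; exists x; split.
    + by move=> j; have /andP[] := x01 j.
    + by move=> j _; have /andP[] := x01 j.
    + by rewrite UW map_mxM map_col_mx map_mx0 z'x.
  move=> [x [x0 x1 zx]].
  have UzE : map_mx intr (Ui *m z) = col_mx 0 (map_mx intr W' *m x) :> 'cV[R]_(r + e).
    by apply: Uinj; rewrite -map_mxM mulKVmx // zx UW.
  have UzE2 : Ui *m z = col_mx 0 (dsubmx (Ui *m z)).
    rewrite -[LHS]vsubmxK; congr (col_mx _ _); apply: (@map_mx_intr_inj R).
    by rewrite map_usubmx UzE col_mxKu map_mx0.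
  apply/mapP; exists (dsubmx (Ui *m z)); last by rewrite -UzE2 mulKVmx.
  apply/X'P; exists x; split=> [j|]; first by rewrite x0 x1 // mem_enum.
  by rewrite map_dsubmx UzE col_mxKd.
- by rewrite size_map sX' detW' detV'.
Qed.

End SmithParallelepiped.

(** * Pivots *)

Section PivotInvariant.
Variables (n r : nat) (B : 'M[int]_(r, n + 1)).
Local Notation BQ := (map_mx intr B : 'M[rat]_(r, n + 1)).

(* With the pivots listed in the order in which they were used, the bottom rows
   are lower triangular with the pivot items on the diagonal. *)
Definition pivot_history (rs : seq 'I_r) (cs : seq 'I_(n + 1)) (t : wterm n r) :=
  [/\ uniq rs, uniq cs, irows t = [set i in rs]%SET, icols t = [set j in cs]%SET &
   [/\ size rs = size (pivots t), size cs = size (pivots t),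
       exists T, mat t = col_mx T (BQ *m T) /\ \det T = 1,
       all (fun x => x != 0) (pivots t) &
       forall i0 j0 a, (a < size (pivots t))%N ->
         bot t (nth i0 rs a) (nth j0 cs a) = nth 0 (pivots t) a /\
         forall j, j \notin take a.+1 cs -> bot t (nth i0 rs a) j = 0]].

(** This is the matrix of the column operations of one pivot. It differs from the identity only in
    row [j], off the diagonal, so expansion along column [j] leaves an identity minor. *)
Lemma det_shear (m : nat) (j : 'I_m) (x : 'I_m -> rat) : x j = 0 ->
  \det (\matrix_(a, k) ((a == k)%:R - (a == j)%:R * x k)) = 1.
Proof.
move=> xj; rewrite (expand_det_col _ j) (bigD1 j) //= big1 => [|i ij]; last first.
  by rewrite !mxE xj mulr0 subr0 (negPf ij) mul0r.
rewrite !mxE xj mulr0 eqxx subr0 mul1r /cofactor addnn -signr_odd odd_double mul1r.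
rewrite -[RHS](det1 _ m.-1); congr (\det _); apply/matrixP => a b.
rewrite !mxE (inj_eq lift_inj) [_ == j]eq_sym (negPf (neq_lift j a)).
by rewrite mul0r subr0.
Qed.

(** A pivot is right multiplication by a shear. It clears row [i] in the columns still visible,
    while earlier pivot rows keep their zeros because column [j] already vanishes there; ignored
    columns are untouched. *)
Lemma pivot_history_step rs cs t w i j : pivot_history rs cs t ->
  i \notin irows t -> j \notin icols t -> bot t i j != 0 ->
  pivot_history (rcons rs i) (rcons cs j) (pivot t w i j).
Proof.
move=> [urs ucs rsE csE [srs scs [T [tT detT]] pn0 tri]] iI jJ bij.
have irs : i \notin rs by move: iI; rewrite rsE inE.
have jcs : j \notin cs by move: jJ; rewrite csE inE.
pose x k := if (k == j) || (k \in icols t) then 0 else bot t i k / bot t i j.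
pose P := \matrix_(a, k) ((a == k)%:R - (a == j)%:R * x k) : 'M[rat]_(n + 1).
have pE : pivot_mx t i j = mat t *m P.
  apply/matrixP => a k; rewrite !mxE.
  under eq_bigr => l _ do rewrite mxE mulrBr.
  rewrite sumrB (bigD1 k) //= eqxx mulr1 big1 ?addr0; last first.
    by move=> l /negPf->; rewrite mulr0.
  rewrite (bigD1 j) //= eqxx mul1r big1 ?addr0; last first.
    by move=> l /negPf->; rewrite mul0r mulr0.
  by rewrite /x; case: ifP => _; rewrite ?mulr0 ?subr0 // mulrC.
have botE a k : bot (pivot t w i j) a k = bot t a k - x k * bot t a j.
  by rewrite /bot /= mxE /x; case: ifP => _; rewrite ?mul0r ?subr0.
split.
- by rewrite rcons_uniq irs.
- by rewrite rcons_uniq jcs.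
- by rewrite /= rsE; apply/setP => k; rewrite !inE mem_rcons inE.
- by rewrite /= csE; apply/setP => k; rewrite !inE mem_rcons inE.
split.
- by rewrite /= !size_rcons srs.
- by rewrite /= !size_rcons scs.
- exists (T *m P); split; first by rewrite /= pE tT mul_col_mx mulmxA.
  by rewrite det_mulmx detT mul1r det_shear // /x eqxx.
- by rewrite /= all_rcons bij.
move=> i0 j0 a; rewrite /= size_rcons ltnS leq_eqVlt => /predU1P[->|ap].
  rewrite !nth_rcons srs scs ltnn eqxx botE; split.
    by rewrite /x eqxx mul0r subr0.
  rewrite take_oversize ?size_rcons ?scs // => k; rewrite mem_rcons inE negb_or.
  move=> /andP[kj kcs]; rewrite botE /x (negPf kj) csE inE (negPf kcs) /=.
  by rewrite mulfVK // subrr.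
have [t1 t2] := tri i0 j0 _ ap.
rewrite !nth_rcons srs scs ap; split.
  by rewrite botE /x csE inE mem_nth ?orbT ?scs // mul0r subr0.
move=> k; rewrite -cats1 take_cat scs; case: ltnP => [ap'|pa] kcs.
  rewrite botE !t2 ?mulr0 ?subr0 //.
  by apply: contra jcs => /mem_take.
move: kcs; rewrite mem_cat negb_or => /andP[kcs _].
have atk : take a.+1 cs = cs by rewrite take_oversize // scs.
by rewrite botE !t2 ?atk ?mulr0 ?subr0.
Qed.

Lemma small_scale_neq0 m (x : rat) (v : 'cV[rat]_m) : small (x *: v) -> x != 0.
Proof.
move=> /existsP[i /andP[+ _]]; rewrite mxE.
by apply: contraTneq => ->; rewrite mul0r ltxx.
Qed.

Lemma large_scale_neq0 m (x : rat) (v : 'cV[rat]_m) : large (x *: v) -> x != 0.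
Proof.
move=> /existsP[i /andP[+ _]]; rewrite mxE.
by apply: contraTneq => ->; rewrite mul0r ltxx.
Qed.

(* Weights play no role in the history, so collecting like terms preserves it. *)
Definition has_history (k : nat) (t : wterm n r) :=
  exists rs cs, size rs = k /\ pivot_history rs cs t.

Lemma CT_row_history k t i u : has_history k t -> i \notin irows t ->
  List.In u (CT_row t i) -> has_history k.+1 u.
Proof.
move=> [rs [cs [srs ht]]] iI.
have step w j : j \notin icols t -> bot t i j != 0 -> has_history k.+1 (pivot t w i j).
  move=> jJ bij; exists (rcons rs i), (rcons cs j); rewrite size_rcons srs.
  by split=> //; exact: pivot_history_step.
rewrite /CT_row; case: ifP => _ /List.in_map_iff[j [<- jin]].
- have : j \in enum (contributing t i).
    by elim: (enum _) jin => //= k' s IH [->|/IH h]; rewrite inE ?eqxx // h orbT.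
  by rewrite mem_enum inE => /andP[jJ /small_scale_neq0]; exact: step.
- have : j \in enum (dually_contributing t i).
    by elim: (enum _) jin => //= k' s IH [->|/IH h]; rewrite inE ?eqxx // h orbT.
  by rewrite mem_enum inE => /andP[jJ /large_scale_neq0]; exact: step.
Qed.

Lemma expand_history k ts us : expand ts us ->
  (forall t, List.In t ts -> has_history k t) ->
  forall u, List.In u us -> has_history k.+1 u.
Proof.
elim=> // t i ts' us' [iI _] _ IH ht u.
rewrite (List.in_app_iff _ us') => -[/CT_row_history|/IH]; apply=> //.
  by apply: ht; left.
by move=> t' t'in; apply: ht; right.
Qed.

Lemma collect_history k ts : (forall t, List.In t ts -> has_history k t) ->
  forall u, List.In u (collect ts) -> has_history k u.
Proof.
move=> hts u; rewrite /collect => /List.filter_In[+ _].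
have : forall t, List.In t (Nil (wterm n r)) -> has_history k t by [].
move: (Nil (wterm n r)) => acc; elim: ts acc hts => [acc _ h /h//|t ts IH acc hts hacc /=].
apply: IH => [t' t'in|]; first by apply: hts; right.
have ht : has_history k t by apply: hts; left.
elim: acc hacc => [|v acc IHacc] hacc t' /=; first by case=> // <-.
have hv : has_history k v by apply: hacc; left.
case: ifP => _ /= [<-|t'in].
- by case: hv => rs [cs hv]; exists rs, cs.
- by apply: hacc; right.
- by [].
- by apply: IHacc t'in => x xin; apply: hacc; right.
Qed.

Lemma rounds_history k ts : simpcone_rounds B k ts ->
  forall t, List.In t ts -> has_history k t.
Proof.
elim=> [t [<-|//]|{}k {}ts us _ IH ex].
  exists [::], [::]; split=> //; split=> //=.
  by split=> //; exists 1%:M; rewrite mulmx1 det1.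
exact: collect_history (expand_history ex IH).
Qed.

(** After [r] pivots every bottom row has been used, so all of them vanish on the visible columns,
    which form [final_mx]. [TJ] collects the ignored columns in pivot order; there the bottom rows,
    reordered likewise, are triangular with the pivot items on the diagonal. *)
Lemma full_history (d : nat) (t : wterm n r) : has_history r t ->
  (n + 1 = r + d.+1)%N ->
  exists (T : 'M[rat]_(n + 1)) (TJ : 'M[rat]_(n + 1, r)) (h : 'I_(r + d.+1) -> 'I_(n + 1)),
  [/\ \det T = 1, injective h, row_mx TJ (final_mx d t) = colsub h T,
      BQ *m final_mx d t = 0 &
      `|\det (BQ *m TJ)| = `|\prod_(x <- pivots t) x| /\ \prod_(x <- pivots t) x != 0].
Proof.
move=> [rs [cs [srs [urs ucs rsE csE [srs' scs [T [tT detT]] pn0 tri]]]]] nr.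
have sp : size (pivots t) = r by rewrite -srs'.
rewrite sp in scs.
pose j0 : 'I_(n + 1) := rshift n ord0.
pose os := enum (~: icols t)%SET.
have sos : size os = d.+1.
  have ci : #|icols t| = r by rewrite csE cardsE (card_uniqP ucs).
  have := cardsC (icols t); rewrite card_ord ci => rh.
  by rewrite -cardE; apply: (@addnI r); rewrite -nr.
have ucos : uniq (cs ++ os).
  rewrite cat_uniq ucs enum_uniq andbT; apply/hasPn => j.
  by rewrite mem_enum !inE csE inE.
pose h (k : 'I_(r + d.+1)) := nth j0 (cs ++ os) k.
pose TJ : 'M[rat]_(n + 1, r) := \matrix_(a, k) T a (nth j0 cs k).
have botE i j : bot t i j = (BQ *m T) i j by rewrite /bot tT col_mxEd.
have VE a k : final_mx d t a k = T a (nth j0 os k).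
  by rewrite mxE tT col_mxEu.
have BTE i (j : 'I_r) : (BQ *m TJ) i j = bot t i (nth j0 cs j).
  by rewrite botE !mxE; apply: eq_bigr => l _; rewrite !mxE.
exists T, TJ, h; split=> //.
- move=> k k' /eqP; rewrite nth_uniq ?size_cat ?scs ?sos //; first by move/eqP/val_inj.
- apply/matrixP => a k; rewrite [LHS]mxE [RHS]mxE /h nth_cat scs.
  case: splitP => k' ->; first by rewrite mxE.
  by rewrite addKn VE.
- apply/matrixP => i k; rewrite [RHS]mxE.
  have -> : (BQ *m final_mx d t) i k = bot t i (nth j0 os k).
    by rewrite botE !mxE; apply: eq_bigr => l _; rewrite VE.
  have irs : i \in rs.
    have : [set x in rs]%SET = [set: 'I_r]%SET.
      by apply/eqP; rewrite eqEcard finset.subsetT cardsT card_ord cardsE (card_uniqP urs) srs leqnn.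
    by move=> /setP/(_ i); rewrite !inE.
  have ai : (index i rs < size (pivots t))%N by rewrite -srs' index_mem.
  have [_ /(_ (nth j0 os k))] := tri i j0 _ ai; rewrite nth_index //; apply.
  have : nth j0 os k \in os by rewrite mem_nth ?sos.
  by rewrite mem_enum !inE csE inE; apply: contra => /mem_take.
split; last by rewrite prodf_seq_neq0.
(* For [r = 0] no row can serve as default value of [nth]; both sides are then empty products. *)
case: (posnP r) => [r0|r_gt0].
  have -> : pivots t = [::] by apply/size0nil; rewrite sp.
  rewrite big_nil; congr (`|_|).
  by move: (BQ *m TJ); rewrite {}r0 => M; rewrite det_mx00.
have i0 : 'I_r by case: (r) r_gt0 => // r' _; exact: ord0.
pose f (a : 'I_r) := nth i0 rs a.
have finj : injective f.
  by move=> a a' /eqP; rewrite nth_uniq ?srs //; move/eqP/val_inj.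
rewrite -(norm_det_rowsub _ finj) det_trig; last first.
  apply/is_trig_mxP => a a' aa'; rewrite mxE BTE.
  have ap : (a < size (pivots t))%N by rewrite sp.
  have [_] := tri i0 j0 _ ap; apply.
  by rewrite in_take ?mem_nth ?scs // index_uniq ?scs // ltnS -ltnNge.
rewrite (big_nth 0) big_mkord sp; congr (`|_|); apply: eq_bigr => a _.
by rewrite mxE BTE; have [] := tri i0 j0 a; rewrite ?sp.
Qed.

End PivotInvariant.

(** * An Abelian theorem *)

Section Abelian.
Variable R : realType.
Implicit Types (x t : R) (a : nat -> R).

(** Pascal's rule: multiplication by 1 - x lowers the index of the binomial coefficients, the
    truncation leaving a boundary term at [T]. *)
Lemma binomial_sum_rec x d T :
  (1 - x) * \sum_(m < T) 'C(m + d.+1, d.+1)%:R * x ^+ m =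
  \sum_(m < T) 'C(m + d, d)%:R * x ^+ m - 'C(T + d, d.+1)%:R * x ^+ T.
Proof.
elim: T => [|T IH]; first by rewrite !big_ord0 add0n bin_small // mul0r subr0 mulr0.
rewrite !big_ord_recr /= mulrDr IH !addnS addSn !binS !natrD exprS; ring.
Qed.

Lemma binomial_sum_le x d T : 0 < x < 1 ->
  (1 - x) ^+ d.+1 * \sum_(m < T) 'C(m + d, d)%:R * x ^+ m <= 1.
Proof.
move=> /andP[x0 x1]; elim: d => [|d IH].
  rewrite expr1; under eq_bigr do rewrite bin0 mul1r.
  have := exprn_ge0 T (ltW x0); rewrite -opprB mulNr -subrX1; lra.
rewrite exprSr -mulrA binomial_sum_rec; apply: le_trans IH.
rewrite ler_wpM2l ?exprn_ge0 ?subr_ge0 ?(ltW x1) // lerBlDr lerDl.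
by rewrite mulr_ge0 // exprn_ge0 // ltW.
Qed.

(** The partial sums are nondecreasing and bounded, so the series converges and its terms tend to
    0. *)
Lemma binomial_term_cvg0 x d : 0 < x < 1 ->
  (fun m => 'C(m + d, d)%:R * x ^+ m) @ \oo --> (0 : R).
Proof.
move=> x01; have /andP[x0 x1] := x01.
apply: cvg_series_cvg_0; apply: nondecreasing_is_cvgn.
  apply: nondecreasing_series => m _ _.
  by rewrite mulr_ge0 // exprn_ge0 // ltW.
exists ((1 - x) ^- d.+1) => _ [T _ <-]; rewrite /series /= big_mkord.
rewrite -[leRHS]mulr1 ler_pdivlMl ?exprn_gt0 ?subr_gt0 //.
exact: binomial_sum_le.
Qed.

Lemma binomial_sum_cvg x d : 0 < x < 1 ->
  (fun T => (1 - x) ^+ d.+1 * \sum_(m < T) 'C(m + d, d)%:R * x ^+ m) @ \oo --> (1 : R).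
Proof.
move=> x01; have /andP[x0 x1] := x01; elim: d => [|d IH].
  rewrite (_ : (fun T => _) = fun T => 1 - x ^+ T); last first.
    apply/funext => T; rewrite expr1; under eq_bigr do rewrite bin0 mul1r.
    by rewrite -opprB mulNr -subrX1 opprB.
  rewrite -[X in _ --> X]subr0; apply: cvgB; first exact: cvg_cst.
  by apply: cvg_expr; rewrite ger0_norm // ltW.
rewrite (_ : (fun T => _) = fun T =>
  (1 - x) ^+ d.+1 * (\sum_(m < T) 'C(m + d, d)%:R * x ^+ m)
   - (1 - x) ^+ d.+1 * ('C(T + d, d.+1)%:R * x ^+ T)); last first.
  by apply/funext => T; rewrite exprSr -mulrA binomial_sum_rec mulrBr.
rewrite -[X in _ --> X]subr0; apply: cvgB => //.
rewrite -(mulr0 ((1 - x) ^+ d.+1)); apply: cvgM; first exact: cvg_cst.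
have := @binomial_term_cvg0 x d.+1 x01.
apply: squeeze_cvgr (cvg_cst _); apply: nearW => T.
rewrite mulr_ge0 ?exprn_ge0 ?(ltW x0) //= ler_wpM2r ?exprn_ge0 ?(ltW x0) //.
by rewrite ler_nat addnS binS leq_addr.
Qed.

(** With [ffact_le_expn], this encloses m^d between d! C(m, d) and d! C(m + d, d), whose generating
    functions are explicit. *)
Lemma expn_le_ffact m d : (m ^ d <= d`! * 'C(m + d, d))%N.
Proof.
rewrite mulnC bin_ffact; elim: d => [|d IH]; first by rewrite expn0 ffactn0.
rewrite expnS addnS ffactnS /= leq_mul //.
exact: leq_trans (leq_addr d m) (leqnSn _).
Qed.

Lemma ffact_le_expn m d : (d`! * 'C(m, d) <= m ^ d)%N.
Proof.
rewrite mulnC bin_ffact; elim: d m => [|d IH] m; first by rewrite expn0 ffactn0.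
case: m => [|m]; first by rewrite ffact0n.
rewrite expnS ffactnS leq_mul //= (leq_trans (IH m)) //.
by case: (d) => // e; rewrite leq_exp2r.
Qed.

Section Asymptotics.
Variables (a : nat -> R) (d : nat) (v : R).
Hypothesis a_ge0 : forall m, 0 <= a m.
Hypothesis a_cvg : (fun m => (m%:R ^+ d)^-1 * a m) @ \oo --> v.

Lemma coef_bounds (e : R) : 0 < e -> exists m0, forall m, (m0 <= m)%N ->
  (v - e) * (d`! * 'C(m, d))%:R <= a m <= (v + e) * (d`! * 'C(m + d, d))%:R.
Proof.
move=> e0; have /cvgrPdist_lt/(_ e e0)[m0 _ h] := a_cvg.
exists m0.+1 => m m0m; have := h m (ltnW m0m); rewrite /= ltr_distlC.
have m_gt0 : 0 < m%:R ^+ d :> R by rewrite exprn_gt0 // ltr0n (leq_trans _ m0m).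
have v0 : 0 <= v.
  rewrite -(cvg_lim _ a_cvg) //; apply: limr_ge.
    by apply/cvg_ex; eexists; exact: a_cvg.
  by apply: nearW => i; rewrite mulr_ge0 // invr_ge0 exprn_ge0.
rewrite mulrC ltr_pdivlMr // ltr_pdivrMr // => /andP[h1 h2].
apply/andP; split.
  (* For v - e negative the lower bound follows from the coefficients being nonnegative. *)
  have [ve|ve] := leP 0 (v - e); last first.
    by apply: le_trans (a_ge0 m); rewrite nmulr_rle0 // ler0n.
  apply: le_trans (ltW h1); rewrite ler_wpM2l // -natrX ler_nat.
  exact: ffact_le_expn.
apply: le_trans (ltW h2) _; rewrite ler_wpM2l //; last first.
  by rewrite -natrX ler_nat expn_le_ffact.
by rewrite addr_ge0 // ltW.
Qed.

(** The first [m0] terms are absorbed by [C], the others dominated by the binomial series. As [C]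
    depends neither on [x] nor on [T], its contribution disappears as x -> 1. *)
Lemma abelian_upper (e : R) : 0 < e -> exists C : R, forall x T, 0 < x < 1 ->
  (1 - x) ^+ d.+1 * \sum_(m < T) a m * x ^+ m
    <= (v + e) * d`!%:R + C * (1 - x) ^+ d.+1.
Proof.
move=> /coef_bounds[m0 am]; exists (\sum_(m < m0) a m) => x T x01.
have /andP[x0 x1] := x01.
have v0 : 0 <= v + e.
  have /andP[_] := am m0 (leqnn _); have := a_ge0 m0 => /le_trans h /h.
  by rewrite pmulr_lge0 // ltr0n muln_gt0 fact_gt0 bin_gt0 leq_addl.
have xm m : 0 <= x ^+ m by rewrite exprn_ge0 // ltW.
have -> : (v + e) * d`!%:R + (\sum_(m < m0) a m) * (1 - x) ^+ d.+1 =
  (1 - x) ^+ d.+1 * (\sum_(m < m0) a m) + (v + e) * d`!%:R * 1 by ring.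
apply: (@le_trans _ _ ((1 - x) ^+ d.+1 * (\sum_(m < m0) a m +
   (v + e) * d`!%:R * \sum_(m < T) 'C(m + d, d)%:R * x ^+ m))); last first.
  rewrite mulrDr lerD2l mulrCA ler_wpM2l ?binomial_sum_le //.
  by rewrite mulr_ge0.
rewrite ler_wpM2l ?exprn_ge0 ?subr_ge0 ?(ltW x1) //.
elim: T => [|T IH]; first by rewrite !big_ord0 mulr0 addr0 sumr_ge0.
have [m0T|Tm0] := leqP m0 T.
  rewrite !big_ord_recr /= mulrDr addrA lerD // mulrA ler_wpM2r //.
  by rewrite -mulrA -natrM; have /andP[] := am _ m0T.
apply: (@le_trans _ _ (\sum_(m < m0) a m)); last first.
  rewrite lerDl !mulr_ge0 // sumr_ge0 // => i _; rewrite mulr_ge0 //.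
have -> : m0 = (T.+1 + (m0 - T.+1))%N by rewrite subnKC.
rewrite big_split_ord /= -[leLHS]addr0 lerD ?sumr_ge0 // ler_sum // => i _.
by rewrite ler_piMr // exprn_ile1 // ltW.
Qed.

(** The comparison is with the coefficients C(m, d), whose series starts at m = d; this accounts for
    the factor x^d, which tends to 1. *)
Lemma abelian_lower (e : R) : 0 < e -> exists C : R, forall x B, 0 < x < 1 ->
  (forall T, \sum_(m < T) a m * x ^+ m <= B) ->
  (v - e) * d`!%:R * x ^+ d - C * (1 - x) ^+ d.+1 <= (1 - x) ^+ d.+1 * B.
Proof.
move=> /coef_bounds[m0 am].
(* This makes up for the first [m0] terms, where the lower bound can fail; v - e may be negative,
   hence the absolute values. *)
pose C := \sum_(m < m0) `|(v - e) * (d`! * 'C(m, d))%:R|.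
exists C => x B x01 aB; have /andP[x0 x1] := x01.
have xm m : 0 <= x ^+ m by rewrite exprn_ge0 // ltW.
have lowT T : (v - e) * d`!%:R * \sum_(m < T) 'C(m, d)%:R * x ^+ m - C <=
    \sum_(m < T) a m * x ^+ m.
  rewrite lerBlDr mulr_sumr /C.
  elim: T => [|T IH]; first by rewrite !big_ord0 add0r sumr_ge0.
  have [m0T|Tm0] := leqP m0 T.
    rewrite !big_ord_recr /= addrAC lerD // mulrA ler_wpM2r //.
    by rewrite -mulrA -natrM; have /andP[] := am _ m0T.
  apply: (@le_trans _ _ (\sum_(m < m0) `|(v - e) * (d`! * 'C(m, d))%:R|)); last first.
    by rewrite lerDr sumr_ge0 // => i _; rewrite mulr_ge0.
  have -> : m0 = (T.+1 + (m0 - T.+1))%N by rewrite subnKC.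
  rewrite [leRHS]big_split_ord /= -[leLHS]addr0 lerD ?sumr_ge0 // ler_sum // => i _.
  rewrite mulrA -[_ * _ * 'C(_, _)%:R]mulrA -natrM; apply: le_trans (ler_norm _) _.
  by rewrite normrM ler_piMr // ger0_norm // exprn_ile1 // ltW.
have cv : (fun T => (v - e) * d`!%:R * x ^+ d * ((1 - x) ^+ d.+1 *
    \sum_(m < T) 'C(m + d, d)%:R * x ^+ m) - C * (1 - x) ^+ d.+1) @ \oo -->
    (v - e) * d`!%:R * x ^+ d - C * (1 - x) ^+ d.+1.
  apply: cvgB; last exact: cvg_cst.
  rewrite -[X in _ --> X]mulr1; apply: cvgM; first exact: cvg_cst.
  exact: binomial_sum_cvg.
rewrite -(cvg_lim _ cv) //; apply: limr_le; first by apply/cvg_ex; eexists; exact: cv.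
apply: nearW => T.
have -> : (v - e) * d`!%:R * x ^+ d * ((1 - x) ^+ d.+1 *
    \sum_(m < T) 'C(m + d, d)%:R * x ^+ m) - C * (1 - x) ^+ d.+1 =
  (1 - x) ^+ d.+1 * ((v - e) * d`!%:R * \sum_(m < d + T) 'C(m, d)%:R * x ^+ m - C).
  rewrite big_split_ord /= [Q in _ * (_ * (Q + _) - _)]big1 ?add0r; last first.
    by move=> i _; rewrite bin_small // mul0r.
  have -> : \sum_(i < T) 'C(d + i, d)%:R * x ^+ (d + i) =
      x ^+ d * \sum_(i < T) 'C(i + d, d)%:R * x ^+ i.
    rewrite mulr_sumr; apply: eq_bigr => i _; rewrite exprD addnC; ring.
  ring.
rewrite ler_wpM2l ?exprn_ge0 ?subr_ge0 ?(ltW x1) //.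
exact: le_trans (lowT _) (aB _).
Qed.

End Asymptotics.
End Abelian.

(** * Constant terms of Laurent expansions *)

Section PowerSeriesInverse.
Variable g : {poly rat}.
Hypothesis g0 : g`_0 != 0.

Let h := 1 - (g`_0)^-1 *: g.

(* With h := 1 - g / g_0, a multiple of 'X, the inverse of g is the geometric
   series (1 / g_0) (1 + h + h^2 + ...). *)
Definition inv_trunc (m : nat) : {poly rat} := (g`_0)^-1 *: \sum_(i < m) h ^+ i.

Let hX i k : (k < i)%N -> (h ^+ i)`_k = 0.
Proof.
have [q ->] : exists q, h = q * 'X.
  exists (\poly_(i < size h) h`_i.+1); apply/poly.polyP => -[|j]; rewrite coefMX /=.
    by rewrite /h coefB coef1 coefZ mulVf // subrr.
  by rewrite coef_poly; case: ltnP => // sj; rewrite nth_default // ltnW.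
by move=> ki; rewrite exprMn coefMXn ki.
Qed.

Lemma mul_inv_trunc m : g * inv_trunc m = 1 - h ^+ m.
Proof.
have gE : g = g`_0 *: (1 - h) by rewrite /h subKr scalerA divff // scale1r.
rewrite /inv_trunc {1}gE -scalerAr -scalerAl scalerA mulVf // scale1r.
by rewrite -opprB mulNr -subrX1 opprB.
Qed.

Lemma coef_mul_inv_trunc m k : (k < m)%N -> (g * inv_trunc m)`_k = (k == 0)%:R.
Proof. by move=> km; rewrite mul_inv_trunc coefB coef1 hX // subr0. Qed.

Definition inv_coef (k : nat) : rat := (inv_trunc k.+1)`_k.

(** Powers h^i with i > k do not reach the coefficient of index [k], so the truncations
    stabilize. *)
Lemma coef_inv_trunc m k : (k < m)%N -> (inv_trunc m)`_k = inv_coef k.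
Proof.
rewrite /inv_coef /inv_trunc !coefZ => km; congr (_ * _).
rewrite !coef_sum -!(big_mkord xpredT (fun i => (h ^+ i)`_k)).
rewrite (big_cat_nat (n := k.+1)) //= [Q in _ + Q]big_nat_cond.
rewrite [Q in _ + Q]big1 ?addr0 // => i /andP[/andP[ki _] _].
exact: hX.
Qed.

Lemma inv_coefP k :
  \sum_(i < size g) (if (i <= k)%N then g`_i * inv_coef (k - i) else 0) = (k == 0)%:R.
Proof.
rewrite -(coef_mul_inv_trunc (ltnSn k)) coefM; rewrite -big_mkcond /=.
rewrite -(big_mkord (fun i => (i <= k)%N) (fun i => g`_i * inv_coef (k - i))).
rewrite -(big_mkord xpredT (fun i => g`_i * (inv_trunc k.+1)`_(k - i))).
have e i : (i <= k)%N -> g`_i * (inv_trunc k.+1)`_(k - i) = g`_i * inv_coef (k - i).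
  by move=> ik; rewrite coef_inv_trunc // ltnS leq_subr.
rewrite [RHS](eq_big_nat _ _ (F2 := fun i => g`_i * inv_coef (k - i))); last first.
  by move=> i /andP[_ ik]; rewrite e.
(* One sum stops at [size g], the other at [k]; zero terms extend both to a common range. *)
set m := maxn (size g) k.+1.
rewrite (big_nat_widen _ _ m) ?leq_maxl // [RHS](big_nat_widen _ _ m) ?leq_maxr //.
rewrite [LHS]big_mkcond [RHS]big_mkcond /=; apply: eq_bigr => i _.
rewrite ltnS; case: leqP => //= ik; case: ltnP => // gi.
by rewrite nth_default // mul0r.
Qed.

End PowerSeriesInverse.

Lemma factor_Xn (P : {poly rat}) : P != 0 ->
  exists (e : nat) (g : {poly rat}), P = g * 'X^e /\ g`_0 != 0.
Proof.
move=> P0; have [m [q]] := multiplicity_XsubC P 0; rewrite P0 /= subr0 => q0 ->.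
exists m, q; split=> //; rewrite -horner_coef0; exact: q0.
Qed.

(** The expansion is q^-e times the power series inverse of [g], so the coefficient of q^k is that
    of index k + e, and 0 when k + e < 0. *)
Lemma laurent_expansion_mulXn (g : {poly rat}) (e : nat) : g`_0 != 0 ->
  laurent_expansion_inv (g * 'X^e)
    (fun k : int => if k + e%:Z is Posz j then inv_coef g j else 0).
Proof.
move=> g0; have gn0 : g != 0 by apply: contraNneq g0 => ->; rewrite coef0.
split.
  exists (- e%:Z) => k ke; case E: (k + e%:Z) => [j|//].
  by move: ke E; lia.
move=> k; rewrite size_mulXn // big_split_ord /= [Q in Q + _]big1 ?add0r; last first.
  by move=> i _; rewrite coefMXn ltn_ord mul0r.
under eq_bigr => i _.
  rewrite coefMXn ltnNge leq_addr /= addKn.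
  have -> : k - (e + i)%N%:Z + e%:Z = k - i%:Z by rewrite PoszD opprD addrAC addrA addrK.
  over.
case: k => [k|k].
  rewrite -(inv_coefP g0 k); apply: eq_bigr => i _.
  case: leqP => ik.
    by rewrite subzn.
  case E: (k%:Z - i%:Z) => [j|]; rewrite ?mulr0 //.
  by exfalso; move: (nat_of_ord i) E ik => i'; clear; lia.
rewrite big1 => [|i _]; first by [].
case E: (Negz k - i%:Z) => [j|]; rewrite ?mulr0 //.
by exfalso; move: (nat_of_ord i) E => i'; clear; lia.
Qed.

(** The difference of two expansions is annihilated by [g] and vanishes in low degrees; as the
    constant coefficient of [g] is nonzero, it vanishes degree by degree. *)
Lemma laurent_expansion_uniq (P : {poly rat}) L L' : P != 0 ->
  laurent_expansion_inv P L -> laurent_expansion_inv P L' -> forall k, L k = L' k.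
Proof.
move=> /factor_Xn[e [g [-> g0]]] [[N LN] LP] [[N' LN'] LP'].
have gn0 : g != 0 by apply: contraNneq g0 => ->; rewrite coef0.
pose Z k := L k - L' k.
have ZP k : \sum_(i < size (g * 'X^e)) (g * 'X^e)`_i * Z (k - i%:Z) = 0.
  by under eq_bigr do rewrite mulrBr; rewrite sumrB LP LP' subrr.
have gZ k : \sum_(i < size g) g`_i * Z (k - i%:Z) = 0.
  rewrite -[RHS](ZP (k + e%:Z)) size_mulXn // [RHS]big_split_ord /=.
  rewrite [Q in _ = Q + _]big1 ?add0r; last first.
    by move=> i _; rewrite coefMXn ltn_ord mul0r.
  apply: eq_bigr => i _; rewrite coefMXn ltnNge leq_addr /= addKn.
  by have -> : k + e%:Z - (e + i)%N%:Z = k - i%:Z by rewrite PoszD opprD addrA addrK.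
pose M := Num.min N N'.
have ZM (j : nat) : forall k : int, k < M + j%:Z -> Z k = 0.
  elim: j => [|j IH] k kj.
    by rewrite /Z LN ?LN' ?subrr //; move: kj; rewrite /M; lia.
  have [/IH//|kj'] := ltP k (M + j%:Z).
  have := gZ k; have : (0 < size g)%N by rewrite lt0n size_poly_eq0.
  case E: (size g) => [//|s] _; rewrite big_ord_recl /= big1 ?addr0.
    by move=> /eqP; rewrite mulf_eq0 (negPf g0) => /eqP.
  by move=> i _; rewrite IH ?mulr0 //; move: kj; rewrite /bump /=; lia.
move=> k; apply/eqP; rewrite -subr_eq0; apply/eqP; apply: (ZM (absz (k - M)).+1).
by lia.
Qed.

Lemma CTq_invE (P : {poly rat}) L : P != 0 -> laurent_expansion_inv P L ->
  CTq_inv P = L 0.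
Proof.
move=> P0 PL; rewrite /CTq_inv; case: xgetP => [c _ [L' PL' ->]|/(_ (L 0))].
  exact: laurent_expansion_uniq PL' PL 0.
by case; exists L.
Qed.

(** * Constant terms from limits along q = 1/m *)

Section LaurentLimit.
Variable R : realType.

Lemma cvg_finite_sum (T I : Type) (F : set_system T) (FF : Filter F) (r : seq I)
    (f : I -> T -> R) (l : I -> R) :
  (forall i, f i x @[x --> F] --> l i) ->
  \sum_(i <- r) f i x @[x --> F] --> \sum_(i <- r) l i.
Proof.
move=> fl; elim: r => [|i r IH].
  by rewrite big_nil; under eq_fun do rewrite big_nil; exact: cvg_cst.
rewrite big_cons; under eq_fun do rewrite big_cons.
exact: cvgD.
Qed.

Lemma cvg_finite_prod (T I : Type) (F : set_system T) (FF : Filter F) (r : seq I)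
    (f : I -> T -> R) (l : I -> R) :
  (forall i, f i x @[x --> F] --> l i) ->
  \prod_(i <- r) f i x @[x --> F] --> \prod_(i <- r) l i.
Proof.
move=> fl; elim: r => [|i r IH].
  by rewrite big_nil; under eq_fun do rewrite big_nil; exact: cvg_cst.
rewrite big_cons; under eq_fun do rewrite big_cons.
exact: cvgM.
Qed.

Lemma cvg_invn : (fun m => (m.+1%:R : R)^-1) @ \oo --> (0 : R).
Proof. exact: (@cvg_harmonic R). Qed.

Lemma cvg_horner_invn (p : {poly rat}) :
  (fun m => ratr p.[m.+1%:R^-1] : R) @ \oo --> (ratr p`_0 : R).
Proof.
have -> : (fun m => ratr p.[m.+1%:R^-1] : R) =
    (fun x => (map_poly ratr p).[x]) \o (fun m => (m.+1%:R)^-1).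
  by apply/funext => m /=; rewrite -horner_map /= fmorphV /= ratr_nat.
rewrite -horner_coef0 -horner_map /= rmorph0.
by apply: cvg_comp cvg_invn _; exact: continuous_horner.
Qed.

(** After subtracting the constant coefficient and dividing by the variable, the quotient tends to 0
    along the integers, so by induction it is zero. *)
Lemma poly_cvg_const (p : {poly R}) (l : R) :
  (fun m => p.[m.+1%:R]) @ \oo --> l -> p = l%:P.
Proof.
elim/poly_ind: p l => [|p c IH] l.
  under eq_fun do rewrite horner0.
  by move=> h; rewrite -(cvg_lim _ h) // lim_cst.
move=> pl; have p0 : (fun m => p.[m.+1%:R]) @ \oo --> (0 : R).
  have -> : (fun m => p.[m.+1%:R]) =
      (fun m => ((p * 'X + c%:P).[m.+1%:R] - c) * (m.+1%:R)^-1).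
    apply/funext => m; rewrite !hornerE addrK mulfK //.
  rewrite -(mulr0 (l - c)); apply: cvgM cvg_invn.
  by apply: cvgB pl _; exact: cvg_cst.
move: pl; rewrite (IH _ p0) mul0r add0r.
under eq_fun do rewrite hornerC.
by move=> h; rewrite -(cvg_lim _ h) // lim_cst.
Qed.

(** [H] is the part of the Laurent expansion of 1/P with nonpositive powers of q, as a polynomial in
    1/q; the remaining terms vanish as q = 1/(m+1) tends to 0. *)
Lemma laurent_principal_part (P : {poly rat}) : P != 0 ->
  exists2 H : {poly rat}, H`_0 = CTq_inv P &
    (fun m => (ratr P.[m.+1%:R^-1])^-1 - ratr H.[m.+1%:R] : R) @ \oo --> (0 : R).
Proof.
move=> P0; have [e [g [PE g0]]] := factor_Xn P0.
(* [u] is 1/g up to degree [e] inclusive, so that the constant term is kept; [H] reverses its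
   coefficients, giving u(q) q^-e = H(1/q). *)
pose u := \poly_(k < e.+1) inv_coef g k.
pose H := \poly_(k < e.+1) inv_coef g (e - k).
have guE k : (k < e.+1)%N -> (g * u)`_k = (k == 0)%:R.
  move=> ke; rewrite -(coef_mul_inv_trunc g0 ke) !coefM; apply: eq_bigr => i _.
  have kie : (k - i < e.+1)%N by rewrite (leq_ltn_trans (leq_subr _ _)).
  by rewrite coef_poly kie coef_inv_trunc.
have [rho gu] : exists rho, g * u = 1 + rho * 'X^(e.+1).
  exists (drop_poly e.+1 (g * u)); rewrite -[LHS](poly_take_drop e.+1); congr (_ + _).
  apply/poly.polyP => k; rewrite coef_take_poly coef1; case: ltnP => [/guE//|].
  by case: k.
exists H.
  have := laurent_expansion_mulXn e g0; rewrite -PE => /(CTq_invE P0) ->.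
  by rewrite coef_poly /= subn0.
have uH m : u.[m.+1%:R^-1] * m.+1%:R ^+ e = H.[m.+1%:R].
  rewrite !horner_poly mulr_suml (reindex_inj rev_ord_inj) /=.
  apply: eq_bigr => i _; rewrite subSS -mulrA.
  have ie : (i <= e)%N by rewrite -ltnS.
  congr (_ * _); rewrite exprVn; move: (nat_of_ord i) ie => j je.
  by rewrite -{2}(subnK je) exprD mulKf // expf_neq0.
have gcv := @cvg_horner_invn g; have rcv := @cvg_horner_invn rho.
have rg0 : ratr g`_0 != 0 :> R by rewrite fmorph_eq0.
have : (fun m => - (ratr rho.[m.+1%:R^-1] * (ratr g.[m.+1%:R^-1])^-1 * (m.+1%:R)^-1) : R)
   @ \oo --> (0 : R).
  rewrite -oppr0 -(mulr0 (ratr rho`_0 * (ratr g`_0)^-1)); apply: cvgN.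
  by apply: cvgM cvg_invn; apply: cvgM rcv _; exact: cvgV.
apply: cvg_trans; apply: near_eq_cvg.
near=> m.
have gm : g.[m.+1%:R^-1] != 0.
  rewrite -(fmorph_eq0 (ratr : {rmorphism rat -> R})).
  by near: m; exact: cvgr_neq0 gcv rg0.
rewrite /=.
rewrite -uH PE hornerM hornerXn.
have -> : (m.+1%:R : R)^-1 = ratr m.+1%:R^-1 by rewrite fmorphV /= ratr_nat.
rewrite -!fmorphV -!rmorphM -rmorphN -rmorphB /=; congr ratr.
have := congr1 (fun p => p.[m.+1%:R^-1]) gu.
rewrite !hornerE; set q := _^-1; set G := g.[q]; set U := u.[q].
have q0 : q != 0 by rewrite invr_eq0.
have -> : m.+1%:R = q^-1 by rewrite invrK.
move=> h; have -> : U = (1 + rho.[q] * q ^+ e.+1) / G by rewrite -h mulrAC divff // mul1r.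
have alg (a b x : rat) : b != 0 -> x != 0 ->
    - (a / b * x) = (b * x ^+ e)^-1 - (1 + a * x ^+ e.+1) / b * x^-1 ^+ e.
  move=> b0 /(expf_neq0 e) x0; rewrite exprS exprVn; move: (x ^+ e) x0 => z z0.
  by field; rewrite b0 z0.
exact: alg.
Unshelve. all: by end_near.
Qed.

(** Single terms may diverge as q tends to 0. Replacing each by its polynomial part in 1/q leaves a
    polynomial [Q] with a finite limit along the integers; hence [Q] is constant, equal to its
    constant coefficient. *)
Lemma CTq_inv_limit (k : nat) (c : 'I_k -> R) (P : 'I_k -> {poly rat}) (l : R) :
  (forall i, P i != 0) ->
  (fun m => \sum_(i < k) c i * (ratr (P i).[m.+1%:R^-1])^-1) @ \oo --> l ->
  \sum_(i < k) c i * ratr (CTq_inv (P i)) = l.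
Proof.
move=> P0 cvl.
have /choice[H HP] : forall i, exists H : {poly rat}, H`_0 = CTq_inv (P i) /\
    (fun m => (ratr (P i).[m.+1%:R^-1])^-1 - ratr H.[m.+1%:R] : R) @ \oo --> (0 : R).
  by move=> i; have [H] := laurent_principal_part (P0 i); exists H.
pose Q := \sum_(i < k) c i *: map_poly ratr (H i) : {poly R}.
have QE m : Q.[m.+1%:R] = \sum_(i < k) c i * ratr (H i).[m.+1%:R].
  rewrite horner_sum; apply: eq_bigr => i _.
  by rewrite hornerZ -(ratr_nat R m.+1) horner_map.
have : (fun m => Q.[m.+1%:R]) @ \oo --> l.
  have cv0 : (fun m => \sum_(i < k) c i *
      ((ratr (P i).[m.+1%:R^-1])^-1 - ratr (H i).[m.+1%:R]) : R) @ \oo --> (0 : R).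
    have cvi i : (fun m => c i * ((ratr (P i).[m.+1%:R^-1])^-1 - ratr (H i).[m.+1%:R]) : R)
        @ \oo --> c i * 0.
      by apply: cvgM; [exact: cvg_cst|exact: (HP i).2].
    have := @cvg_finite_sum _ _ _ eventually_filter (index_enum 'I_k) _ _ cvi.
    by rewrite big1 // => i _; rewrite mulr0.
  have -> : (fun m => Q.[m.+1%:R]) = (fun m =>
      \sum_(i < k) c i * (ratr (P i).[m.+1%:R^-1])^-1 - \sum_(i < k) c i *
      ((ratr (P i).[m.+1%:R^-1])^-1 - ratr (H i).[m.+1%:R])).
    apply/funext => m; rewrite QE -sumrB; apply: eq_bigr => i _ /=.
    by rewrite -mulrBr subKr.
  by rewrite -[l]subr0; exact: cvgB.
move=> /poly_cvg_const QC; have := congr1 (fun p : {poly R} => p`_0) QC; rewrite /= coefC /= => <-.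
rewrite coef_sum; apply: eq_bigr => i _; rewrite coefZ coef_map /=.
by rewrite (HP i).1.
Qed.

End LaurentLimit.

(** * Lattice points of the cone over the polytope *)

Definition height (n : nat) (a : 'cV[int]_(n + 1)) : int := dsubmx a 0 0.

Definition pairing (n : nat) (beta : 'cV[int]_n) (a : 'cV[int]_(n + 1)) : int :=
  (beta^T *m usubmx a) 0 0.

Section ConeSlices.
Variables (R : realType) (r n : nat) (A : 'M[int]_(r, n)) (b : 'cV[int]_r).
Hypotheses (bddP : coord_bounded (polyP R A b)) (P0 : exists x, polyP R A b x).
Local Notation P := (polyP R A b).
Local Notation cone := (coneP R (row_mx A (- b))).

Lemma coneP_col_mx (x : 'cV[R]_n) (m : R) :
  cone (col_mx x m%:M) <->
  [/\ forall i, 0 <= x i 0, 0 <= m & map_mx intr A *m x = m *: map_mx intr b].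
Proof.
have E : map_mx intr (row_mx A (- b)) *m col_mx x m%:M =
    map_mx intr A *m x - m *: map_mx intr b :> 'cV[R]_r.
  by rewrite map_row_mx mul_row_col map_mxN mulNmx mul_mx_scalar.
rewrite /coneP /= E; split.
  move=> [x0 /eqP]; rewrite subr_eq0 => /eqP ->; split=> // [i|].
    by have := x0 (lshift 1 i); rewrite col_mxEu.
  by have := x0 (rshift n ord0); rewrite col_mxEd mxE eqxx.
move=> [x0 m0 ->]; rewrite subrr; split=> // i.
by rewrite -[i]splitK; case: (fintype.split i) => j /=; rewrite ?col_mxEu ?col_mxEd // mxE ord1 eqxx.
Qed.

Lemma recession_trivial (x : 'cV[R]_n) :
  (forall i, 0 <= x i 0) -> map_mx intr A *m x = 0 -> x = 0.
Proof.
move=> x0 Ax; have [y [y0 Ay]] := P0; have [M PM] := bddP.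
apply/colP => i; rewrite [RHS]mxE; apply/eqP; rewrite eq_le x0 andbT leNgt.
(* This [s] pushes the [i]-th coordinate of y + s x to at least |M| + 1, beyond the bound on P. *)
apply/negP => xi; pose s := (`|M| + 1) / x i 0.
have s0 : 0 <= s by rewrite divr_ge0 ?addr_ge0 // ltW.
have /PM/(_ i) : P (y + s *: x).
  split=> [j|]; first by rewrite !mxE addr_ge0 // mulr_ge0.
  by rewrite mulmxDr -scalemxAr Ax scaler0 addr0.
rewrite !mxE /s mulfVK ?gt_eqF // ger0_norm ?addr_ge0 //.
by have := y0 i; have := ler_norm M; lra.
Qed.

Lemma coneP_dilate (x : 'cV[R]_n) (m : nat) :
  cone (col_mx x m%:R%:M) <-> [set m%:R *: y | y in P] x.
Proof.
split=> [/coneP_col_mx[x0 _ Ax]|[y [y0 Ay] <-]]; last first.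
  apply/coneP_col_mx; split=> // [i|]; first by rewrite mxE mulr_ge0.
  by rewrite -scalemxAr Ay.
(* At height 0 the slice is the origin, which is 0 times any point of the nonempty P. *)
have [m0|m0] := eqVneq m 0%N.
  have [y Py] := P0; exists y => //; rewrite m0 scale0r; apply/esym.
  by apply: recession_trivial => //; rewrite Ax m0 scale0r.
have mR : (m%:R : R) != 0 by rewrite pnatr_eq0.
exists (m%:R^-1 *: x); last by rewrite scalerA divff // scale1r.
split=> [i|]; first by rewrite mxE mulr_ge0 // invr_ge0.
by rewrite -scalemxAr Ax scalerA mulVf // scale1r.
Qed.

Lemma col_mx_height (a : 'cV[int]_(n + 1)) :
  a = col_mx (usubmx a) (height a)%:M.
Proof. by rewrite -[LHS]vsubmxK; congr col_mx; rewrite [LHS]mx11_scalar. Qed.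

Lemma height_ge0 (a : 'cV[int]_(n + 1)) : cone (map_mx intr a) -> 0 <= height a.
Proof.
by case=> /(_ (rshift n ord0)) + _; rewrite mxE ler0z /height !mxE; congr (_ <= a _ _); apply/val_inj.
Qed.

Lemma coneP_int (a : 'cV[int]_(n + 1)) (m : nat) : height a = m%:Z ->
  cone (map_mx intr a) <-> [set m%:R *: y | y in P] (map_mx intr (usubmx a)).
Proof.
move=> am; rewrite [in X in X <-> _](col_mx_height a) am map_col_mx map_scalar_mx /=.
exact: coneP_dilate.
Qed.

Lemma coord_bound : exists M : nat, forall (a : 'cV[int]_(n + 1)) (m : nat),
  height a = m%:Z -> cone (map_mx intr a) ->
  forall i, 0 <= usubmx a i 0 <= (M * m)%N%:Z.
Proof.
have [M PM] := bddP; exists (absz (Num.ceil `|M|)) => a m am.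
move=> /(coneP_int am)[y Py ya] i.
have yE : (usubmx a i 0)%:~R = m%:R * y i 0 :> R.
  by have := congr1 (fun z : 'cV[R]_n => z i 0) ya; rewrite /= !mxE.
rewrite -(ler0z R) -(ler_int R) yE mulr_ge0 ?Py.1 //= PoszM intrM mulrC.
rewrite ler_wpM2r // gez0_abs; last by rewrite ceil_ge0 (lt_le_trans _ (normr_ge0 M)) ?ltrN10.
apply: le_trans (ler_norm _) _; apply: le_trans (PM _ Py i) _.
exact: le_trans (ler_norm M) (ceil_ge _).
Qed.

Lemma pairing_bound (beta : 'cV[int]_n) : exists M : nat,
  forall (a : 'cV[int]_(n + 1)) (m : nat),
  height a = m%:Z -> cone (map_mx intr a) -> (absz (pairing beta a) <= M * m)%N.
Proof.
have [M aM] := coord_bound; exists (\sum_i absz (beta i 0%R) * M)%N => a m am Ca.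
rewrite /pairing mxE big_distrl /=.
apply: (@leq_trans (\sum_i absz (beta i 0%R) * absz (usubmx a i 0%R))).
  elim/big_rec2: _ => // i x y _ xy; rewrite mxE.
  apply: leq_trans (leq_add (leqnn _) xy); rewrite -abszM; clear; lia.
apply: leq_sum => i _; rewrite -mulnA leq_mul2l; apply/orP; right.
have := aM a m am Ca i; move: (usubmx a i 0) (M * m)%N; clear; lia.
Qed.

Lemma slice_finite (m : nat) :
  finite_set [set z : 'cV[int]_n | [set m%:R *: x | x in P] (map_mx intr z)].
Proof.
have [M aM] := coord_bound.
pose f (g : {ffun 'I_n -> 'I_(M * m).+1}) : 'cV[int]_n := \col_i (g i : nat)%:Z.
apply: sub_finite_set (finite_image f (@finite_finset _ setT)) => z Pz.
have hz : height (col_mx z m%:Z%:M) = m%:Z by rewrite /height col_mxKd mxE eqxx.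
have zM i : 0 <= z i 0 <= (M * m)%N%:Z.
  have Cz : cone (map_mx intr (col_mx z m%:Z%:M)).
    by apply/(coneP_int hz); rewrite col_mxKu.
  by have := aM _ _ hz Cz i; rewrite col_mxKu.
exists [ffun i => inord (absz (z i 0))] => //; apply/colP => i.
rewrite mxE ffunE inordK; have := zM i; move: (z i 0) (M * m)%N; clear; lia.
Qed.

(** The slice of the cone at height m is mP, so listing lattice points slice by slice turns sums
    over the cone into one-variable series with coefficients [lattice_count P m]. *)
Lemma cone_truncation : exists Y : nat -> seq 'cV[int]_(n + 1),
  [/\ forall T, uniq (Y T),
      forall T a, a \in Y T <-> cone (map_mx intr a) /\ height a < T%:Z &
      forall (y : R) T, \sum_(a <- Y T) y ^+ absz (height a) =
        \sum_(m < T) (lattice_count P m)%:R * y ^+ m].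
Proof.
pose slice m := [seq col_mx z m%:Z%:M | z <- fset_set
  [set z : 'cV[int]_n | [set m%:R *: x | x in P] (map_mx intr z)]].
have hs z m : height (col_mx z m%:Z%:M : 'cV[int]_(n + 1)) = m%:Z.
  by rewrite /height col_mxKd mxE eqxx.
have us m : uniq (slice m).
  by rewrite map_inj_uniq ?fset_uniq // => z z' /eq_col_mx[].
have sP m a : a \in slice m <-> cone (map_mx intr a) /\ height a = m%:Z.
  split=> [/mapP[z]|[Ca am]].
    rewrite in_fset_set; last exact: slice_finite.
    move=> /set_mem Pz ->; rewrite hs; split=> //.
    by apply/(coneP_int (hs z m)); rewrite col_mxKu.
  apply/mapP; exists (usubmx a); last by rewrite -am -col_mx_height.
  rewrite in_fset_set; last exact: slice_finite.
  by apply/mem_set; apply/(coneP_int am).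
pose fix Y T := if T is T'.+1 then Y T' ++ slice T' else [::].
have YP T a : a \in Y T <-> cone (map_mx intr a) /\ height a < T%:Z.
  elim: T => [|T IH] /=.
    by split=> // -[/height_ge0]; rewrite leNgt => /negPf->.
  rewrite mem_cat; split.
    move=> /orP[/IH[Ca aT]|/sP[Ca ->]]; split=> //; last by rewrite ltz_nat.
    by apply: lt_trans aT _; rewrite ltz_nat.
  move=> [Ca aT]; apply/orP.
  have [aT'|aT'] := ltP (height a) T%:Z; first by left; apply/IH.
  right; apply/sP; split=> //; move: aT aT'; move: (height a); clear; lia.
exists Y; split=> //.
  elim=> //= T IH; rewrite cat_uniq IH us andbT; apply/hasPn => a /sP[_ aT].
  by apply/negP => /YP[_]; rewrite aT ltxx.
move=> y; elim=> [|T IH] /=; first by rewrite big_nil big_ord0.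
rewrite big_cat /= IH big_ord_recr /=; congr (_ + _).
rewrite /slice big_map; under eq_bigr do rewrite hs /=.
by rewrite big_const_seq count_predT iter_addr_0 [RHS]mulr_natl.
Qed.

End ConeSlices.

(** * The leading term of the generating function *)

Section LimitsAtOne.
Variables (R : realType) (u : nat -> R).
Hypotheses (u01 : forall l, 0 < u l < 1) (u1 : u @ \oo --> (1 : R)).

Lemma cvg_exprn1 (m : nat) : (fun l => u l ^+ m) @ \oo --> (1 : R).
Proof.
rewrite -(expr1n R m); apply: (cvg_comp _ (fun x : R => x ^+ m)) u1 _.
exact: exprn_continuous.
Qed.

Lemma cvg_exprz1 (k : int) : (fun l => u l ^ k) @ \oo --> (1 : R).
Proof.
case: k => m; first exact: cvg_exprn1.
rewrite -invr1; apply: cvgV; first exact: oner_neq0.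
exact: cvg_exprn1.
Qed.

Lemma cvg_geom_ratio_nat (m : nat) :
  (fun l => (1 - u l ^+ m) / (1 - u l)) @ \oo --> (m%:R : R).
Proof.
have -> : (fun l => (1 - u l ^+ m) / (1 - u l)) = fun l => \sum_(i < m) u l ^+ i.
  apply/funext => l; have /andP[_ ul] := u01 l.
  by rewrite -opprB subrX1 -mulNr opprB mulrAC divff ?mul1r // subr_eq0 gt_eqF.
have -> : m%:R = \sum_(i < m) (1 : R) by rewrite sumr_const card_ord.
by apply: (@cvg_finite_sum R _ _ \oo _ _ (fun i : 'I_m => fun l => u l ^+ i)) => i; exact: cvg_exprn1.
Qed.

Lemma cvg_geom_ratio (k : int) :
  (fun l => (1 - u l ^ k) / (1 - u l)) @ \oo --> (k%:~R : R).
Proof.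
case: k => m; first exact: cvg_geom_ratio_nat.
rewrite NegzE mulrNz -[X in _ --> X]mul1r mulrN.
(* Negative exponents reduce to positive ones by 1 - u^(-k) = - u^(-k) (1 - u^k). *)
have -> : (fun l => (1 - u l ^ (- m.+1%:Z)) / (1 - u l)) =
    fun l => - (u l ^ (- m.+1%:Z) * ((1 - u l ^+ m.+1) / (1 - u l))).
  apply/funext => l; have /andP[ul _] := u01 l.
  rewrite mulrA -mulNr; congr (_ / _); rewrite mulrBr mulr1 opprB.
  by rewrite -exprnN mulVf // expf_neq0 // gt_eqF.
apply: cvgN; apply: cvgM; [exact: cvg_exprz1|exact: cvg_geom_ratio_nat].
Qed.

End LimitsAtOne.

(** * Two-sided estimates of the volume *)

Section VolumeSandwich.
Variables (R : realType) (r n d k : nat) (A : 'M[int]_(r, n)) (b : 'cV[int]_r).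
Hypotheses (bddP : coord_bounded (polyP R A b)) (P0 : exists x, polyP R A b x).
Local Notation P := (polyP R A b).
Local Notation cone := (coneP R (row_mx A (- b))).
Variables (s : 'I_k -> int) (G : 'I_k -> 'cV[int]_(n + 1) -> rat).
Variables (W : 'I_k -> 'M[int]_(n + 1, d.+1)) (X : 'I_k -> seq 'cV[int]_(n + 1)).
Hypothesis GX : forall i, shift_diffs [seq col j (W i) | j <- enum 'I_d.+1] (G i) =
  fun z => (z \in X i)%:R.
Hypothesis uX : forall i, uniq (X i).
Hypothesis hdec : ratfun_eq_sum (sigma cone) s G.
Variables (v : R) (beta : 'cV[int]_n) (M : nat).
Hypothesis hvol : dilation_ratio P d @ \oo --> v.
Hypothesis betaM : forall (a : 'cV[int]_(n + 1)) (m : nat),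
  height a = m%:Z -> cone (map_mx intr a) -> (absz (pairing beta a) <= M * m)%N.

(** The exponent of t in the substitution y^(nu, m) = t^(N m - beta.nu); [N] plays the role of
    1/q. *)
Definition grade (N : nat) (a : 'cV[int]_(n + 1)) : int :=
  N%:Z * height a - pairing beta a.

Lemma gradeD N a a' : grade N (a + a') = grade N a + grade N a'.
Proof.
have heightD : height (a + a') = height a + height a'.
  by rewrite /height linearD mxE.
have pairingD : pairing beta (a + a') = pairing beta a + pairing beta a'.
  by rewrite /pairing linearD mulmxDr mxE.
by rewrite /grade heightD pairingD mulrDr opprD addrACA.
Qed.

Variable N : nat.
Hypothesis MN : (M < N)%N.

(** Since |beta.nu| <= M m on the cone, the substituted series lies between the height series at
    t^(N + M) and at t^(N - M). *)
Lemma grade_bounds a : cone (map_mx intr a) -> exists m : nat,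
  height a = m%:Z /\ exists2 l : nat, grade N a = l%:Z &
    ((N - M) * m <= l <= (N + M) * m)%N.
Proof.
move=> Ca; have := height_ge0 Ca; case hm: (height a) => [m|//] _; exists m; split=> //.
have := betaM hm Ca; rewrite /grade hm; move: (pairing beta a) MN; clear=> p MN pM.
exists (absz (N%:Z * m%:Z - p)%R); nia.
Qed.

Section FixedParameter.
Variable t : R.
Hypothesis t01 : 0 < t < 1.
Let chi a := t ^ grade N a.

Lemma chiD a a' : chi (a + a') = chi a * chi a'.
Proof. by rewrite /chi gradeD expfzDr // gt_eqF //; case/andP: t01. Qed.

Let F a : R := ratr (sigma cone a) * chi a.

Lemma sigma_chi_ge0 a : 0 <= F a.
Proof.
rewrite /F mulr_ge0 ?ler0q // /chi exprz_ge0 // ltW //.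
by case/andP: t01.
Qed.

Lemma sigma_chi_bounds a : cone (map_mx intr a) ->
  (t ^+ (N + M)) ^+ absz (height a) <= F a <= (t ^+ (N - M)) ^+ absz (height a).
Proof.
move=> Ca; have [m [hm [l gl /andP[l1 l2]]]] := grade_bounds Ca.
have /andP[/ltW t0 /ltW t1] := t01.
rewrite /F /sigma asboolT // rmorph1 mul1r /chi gl hm /= -!exprM.
by apply/andP; split; apply: ler_wiXn2l.
Qed.

Lemma sigma_chi_notin a : ~ cone (map_mx intr a) -> F a = 0.
Proof. by move=> Ca; rewrite /F /sigma asboolF // rmorph0 mul0r. Qed.

Lemma eval_upper (Z : {fset 'cV[int]_(n + 1)}) : exists T,
  \sum_(a <- Z) F a <= \sum_(m < T) (lattice_count P m)%:R * (t ^+ (N - M)) ^+ m.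
Proof.
have [Y [uY YP Ysum]] := cone_truncation bddP P0.
have /andP[t0 t1] := t01.
(* [T] exceeds the heights of all points of [Z]. *)
pose T := (\sum_(a <- Z) absz (height a)).+1.
exists T; rewrite -Ysum.
apply: (@le_trans _ _ (\sum_(a <- [seq a <- Z | `[< cone (map_mx intr a) >]]) F a)).
  rewrite big_filter [leRHS]big_mkcond /=; apply: ler_sum => a _.
  by case: asboolP => // /sigma_chi_notin ->.
apply: (@le_trans _ _ (\sum_(a <- [seq a <- Z | `[< cone (map_mx intr a) >]])
    (t ^+ (N - M)) ^+ absz (height a))).
  rewrite !big_filter; apply: ler_sum => a /asboolP/sigma_chi_bounds/andP[_]; exact.
apply: ler_sum_subset => //; rewrite ?filter_uniq ?fset_uniq //.
  by move=> a; rewrite !exprn_ge0 // ltW.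
move=> a; rewrite mem_filter => /andP[/asboolP Ca aZ]; apply/YP; split=> //.
have : (absz (height a) < T)%N by rewrite ltnS (big_rem a) //= leq_addr.
have := height_ge0 Ca; move: (height a) T; clear; lia.
Qed.

Lemma eval_lower S T : has_usum F S ->
  \sum_(m < T) (lattice_count P m)%:R * (t ^+ (N + M)) ^+ m <= S.
Proof.
move=> FS; have [Y [uY YP Ysum]] := cone_truncation bddP P0; rewrite -Ysum.
apply: le_trans (has_usum_ge FS sigma_chi_ge0 (uY T)).
rewrite big_seq [leRHS]big_seq; apply: ler_sum => a /YP[Ca _].
by have /andP[] := sigma_chi_bounds Ca.
Qed.

Lemma expr_in01 K : (0 < K)%N -> 0 < t ^+ K < 1.
Proof. by have /andP[t0 t1] := t01 => K0; rewrite exprn_gt0 ?exprn_ilt1 ?ltW // -lt0n. Qed.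

Lemma eval_exists : exists S, has_usum F S.
Proof.
have [C Cu] := abelian_upper (fun m => ler0n _ (lattice_count P m)) hvol ltr01.
have x01 : 0 < t ^+ (N - M) < 1 by apply: expr_in01; rewrite subn_gt0.
set x := t ^+ (N - M) in x01.
apply: (@has_usum_nonneg _ _ _ (((v + 1) * d`!%:R + C * (1 - x) ^+ d.+1) / (1 - x) ^+ d.+1)).
  exact: sigma_chi_ge0.
move=> Z; have [T /le_trans] := eval_upper Z; apply.
rewrite ler_pdivlMr 1?mulrC ?Cu //.
by rewrite exprn_gt0 // subr_gt0; case/andP: x01.
Qed.

Hypothesis grade_neq0 : forall i j, grade N (col j (W i)) != 0.

(** No generator has [grade] zero, so no factor of the denominators vanishes for 0 < t < 1 and the
    rational identity can be evaluated. *)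
Lemma eval_formula S : has_usum F S ->
  S = \sum_(i < k) (s i)%:~R *
    ((\sum_(a <- X i) t ^ grade N a) / \prod_(j < d.+1) (1 - t ^ grade N (col j (W i)))).
Proof.
move=> FS.
have Fb : bounded_below_supp (sigma cone).
  exists 0 => a; rewrite /sigma; case: asboolP => //; rewrite ?eqxx //.
  by move=> [a0 _] _ i; have := a0 i; rewrite mxE ler0z.
have fs i : finsupp_fun (fun z : 'cV[int]_(n + 1) => (z \in X i)%:R).
  by exists (X i) => a; case: (a \in X i) => //; rewrite eqxx.
rewrite (eval_ratfun_eq_sum chiD (P := fun i => \sum_(a <- X i) chi a) hdec Fb fs GX _ FS).
- by apply: eq_bigr => i _; rewrite big_map big_enum.
- move=> i w /mapP[j _ ->]; rewrite /chi; move: (grade_neq0 i j).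
  have tl l : (0 < l)%N -> t ^+ l != 1 by move=> /expr_in01/andP[_ /lt_eqF->].
  case: (grade N _) => [l l0|l _]; first by apply: tl; rewrite lt0n.
  by rewrite NegzE -exprnN -invr1 (inj_eq invr_inj) tl.
- move=> i; rewrite /has_eval.
  have -> : \sum_(a <- X i) chi a = \sum_(a <- X i) ratr (a \in X i)%:R * chi a.
    by rewrite big_seq [RHS]big_seq; apply: eq_bigr => a ->; rewrite rmorph1 mul1r.
  by apply: has_usum_finite => // a /negPf->; rewrite rmorph0 mul0r.
Qed.

End FixedParameter.

Hypothesis grade_neq0 : forall i j, grade N (col j (W i)) != 0.

(* The limit of (1 - t)^(d+1) times the generating function, as t -> 1. *)
Definition polar_coef : R := \sum_(i < k) (s i)%:~R *
    ((size (X i))%:R / \prod_(j < d.+1) (grade N (col j (W i)))%:~R).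

(** (1 - t)^(d+1) times the generating function tends to [polar_coef] as t -> 1. With 1 - t^K in
    place of 1 - t the limit gains the factor K^(d+1). The Abelian upper estimate applies with K = N
    - M, the lower one with K = N + M. *)
Lemma volume_sandwich :
  (N - M)%:R ^+ d.+1 * polar_coef <= v * d`!%:R <= (N + M)%:R ^+ d.+1 * polar_coef.
Proof.
(* A sequence tending to 1; the shift by 2 keeps it strictly positive. *)
set Phi := polar_coef; pose u (l : nat) : R := 1 - l.+2%:R^-1.
have u01 l : 0 < u l < 1.
  rewrite /u subr_gt0 invf_lt1 ?ltr0n // ltr1n /= ltrBlDr ltrDl invr_gt0 ltr0n //.
have u1 : u @ \oo --> (1 : R).
  rewrite -[X in _ --> X]subr0; apply: cvgB; first exact: cvg_cst.
  have := @cvg_invn R; rewrite -(cvg_shiftS (fun m : nat => m.+1%:R^-1 : R)); exact.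
have [S FS] := choice (fun l => eval_exists (u01 l)).
have SPhi : (fun l => (1 - u l) ^+ d.+1 * S l) @ \oo --> Phi.
  have -> : (fun l => (1 - u l) ^+ d.+1 * S l) = fun l => \sum_(i < k) (s i)%:~R *
      ((\sum_(a <- X i) u l ^ grade N a) *
       (\prod_(j < d.+1) ((1 - u l ^ grade N (col j (W i))) / (1 - u l)))^-1).
    apply/funext => l; rewrite (eval_formula (u01 l) grade_neq0 (FS l)) mulr_sumr.
    apply: eq_bigr => i _; rewrite mulrCA; congr (_ * _); rewrite mulrCA; congr (_ * _).
    have ul : 1 - u l != 0 by have /andP[_ h] := u01 l; rewrite subr_eq0 gt_eqF.
    rewrite prodf_div prodr_const card_ord invf_div //.
  apply: (@cvg_finite_sum R _ _ \oo _ _ (fun (i : 'I_k) l => (s i)%:~R *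
      ((\sum_(a <- X i) u l ^ grade N a) *
       (\prod_(j < d.+1) ((1 - u l ^ grade N (col j (W i))) / (1 - u l)))^-1))) => i.
  apply: cvgM; first exact: cvg_cst.
  apply: cvgM.
    have -> : (size (X i))%:R = \sum_(a <- X i) (1 : R).
      by rewrite big_const_seq count_predT iter_addr_0.
    by apply: (@cvg_finite_sum R _ _ \oo _ _ (fun a l => u l ^ grade N a)) => a; exact: (cvg_exprz1 u1).
  apply: cvgV.
    by rewrite prodf_seq_neq0; apply/allP => j _; rewrite intr_eq0 /=.
  apply: (@cvg_finite_prod R _ _ \oo _ _
    (fun (j : 'I_d.+1) l => (1 - u l ^ grade N (col j (W i))) / (1 - u l))) => j.
  exact: (cvg_geom_ratio u01 u1).
have Scv K : (fun l => (1 - u l ^+ K) ^+ d.+1 * S l) @ \oo --> K%:R ^+ d.+1 * Phi.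
  have -> : (fun l => (1 - u l ^+ K) ^+ d.+1 * S l) = fun l =>
      ((1 - u l ^+ K) / (1 - u l)) ^+ d.+1 * ((1 - u l) ^+ d.+1 * S l).
    apply/funext => l; rewrite mulrA -exprMn mulfVK //.
    by have /andP[_ h] := u01 l; rewrite subr_eq0 gt_eqF.
  apply: cvgM => //.
  apply: (cvg_comp (fun l => (1 - u l ^+ K) / (1 - u l)) (fun x : R => x ^+ d.+1)).
    exact: (cvg_geom_ratio_nat u01 u1).
  exact: exprn_continuous.
have xcv K : (fun l => (1 - u l ^+ K) ^+ d.+1) @ \oo --> (0 : R).
  have -> : (0 : R) = (1 - 1) ^+ d.+1 by rewrite subrr expr0n.
  apply: (cvg_comp (fun l => 1 - u l ^+ K) (fun x : R => x ^+ d.+1)); last exact: exprn_continuous.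
  by apply: cvgB; [exact: cvg_cst|exact: (cvg_exprn1 u1)].
have cnt0 m : 0 <= (lattice_count P m)%:R :> R by exact: ler0n.
apply/andP; split; apply/ler_addgt0Pl => e e0.
- have e'0 : 0 < e / d`!%:R by rewrite divr_gt0 // ltr0n fact_gt0.
  have [C CP] := abelian_upper cnt0 hvol e'0.
  have rcv : (fun l => (v + e / d`!%:R) * d`!%:R + C * (1 - u l ^+ (N - M)) ^+ d.+1) @ \oo -->
      (v + e / d`!%:R) * d`!%:R + C * 0.
    by apply: cvgD; [exact: cvg_cst|apply: cvgM; [exact: cvg_cst|exact: xcv]].
  suff : (N - M)%:R ^+ d.+1 * Phi <= (v + e / d`!%:R) * d`!%:R + C * 0.
    rewrite mulr0 addr0 mulrDl mulfVK; first by rewrite [e + _]addrC.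
    by rewrite pnatr_eq0 -lt0n fact_gt0.
  apply: (ler_cvg_to (Scv (N - M)%N) rcv); apply: nearW => l.
  have x01 : 0 < u l ^+ (N - M) < 1 by apply: (expr_in01 (u01 l)); rewrite subn_gt0.
  rewrite mulrC -ler_pdivlMr; last first.
    by rewrite exprn_gt0 // subr_gt0; case/andP: x01.
  apply: has_usum_le (FS l) _ => Z; have [T /le_trans] := eval_upper (u01 l) Z; apply.
  rewrite ler_pdivlMr 1?mulrC ?CP //.
  by rewrite exprn_gt0 // subr_gt0; case/andP: x01.
- have e'0 : 0 < e / d`!%:R by rewrite divr_gt0 // ltr0n fact_gt0.
  have [C CP] := abelian_lower cnt0 hvol e'0.
  have rcv : (fun l => (v - e / d`!%:R) * d`!%:R * (u l ^+ (N + M)) ^+ d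
      - C * (1 - u l ^+ (N + M)) ^+ d.+1) @ \oo -->
      (v - e / d`!%:R) * d`!%:R * 1 - C * 0.
    apply: cvgB; last by apply: cvgM; [exact: cvg_cst|exact: xcv].
    apply: cvgM; first exact: cvg_cst.
    by under eq_fun do rewrite -exprM; exact: (cvg_exprn1 u1).
  suff : (v - e / d`!%:R) * d`!%:R * 1 - C * 0 <= (N + M)%:R ^+ d.+1 * Phi.
    rewrite mulr0 subr0 mulr1 mulrBl mulfVK; first by rewrite lerBlDl.
    by rewrite pnatr_eq0 -lt0n fact_gt0.
  apply: (ler_cvg_to rcv (Scv (N + M)%N)); apply: nearW => l.
  apply: CP => [|T]; last exact: eval_lower (FS l).
  by apply: (expr_in01 (u01 l)); rewrite addn_gt0 (leq_ltn_trans _ MN).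
Qed.

End VolumeSandwich.

(** * The volume formula *)

(** A transport along N = r + e, since the types of the tableaux mention n + 1 and not r + d.+1. *)
Lemma smith_parallelepiped_cast (R : realType) (r e N : nat) (eN : N = (r + e)%N)
    (B : 'M[int]_(r, N)) (D : 'I_r -> int) (T : 'M[rat]_N) (TJ : 'M[rat]_(N, r))
    (V : 'M[rat]_(N, e)) (h : 'I_(r + e) -> 'I_N) (q : rat) (c : int)
    (W : 'M[int]_(N, e)) :
  smith_normal_form B D -> `|\det T| = 1 -> injective h ->
  row_mx TJ V = colsub h T -> map_mx intr B *m V = 0 ->
  `|\det (map_mx intr B *m TJ)| = `|q| -> q != 0 -> 0 < c ->
  map_mx intr W = c%:~R *: V ->
  exists X : seq 'cV[int]_N,
  [/\ uniq X, forall z, z \in X <-> half_open R W (enum 'I_e) z &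
      (size X)%:R = c%:~R ^+ e * `|(\prod_i D i)%:~R / q| :> rat].
Proof. by subst N; exact: smith_parallelepiped. Qed.

Lemma In_mem (T : eqType) (x : T) (l : seq T) : x \in l -> List.In x l.
Proof.
by elim: l => //= y l IH; rewrite inE => /predU1P[->|/IH]; [left|right].
Qed.

Lemma simpcone_history (n r d k : nat) (B : 'M[int]_(r, n + 1)) (s : 'I_k -> int)
    (V : 'I_k -> 'M[rat]_(n + 1, d.+1)) (p : 'I_k -> seq rat) (i : 'I_k) :
  simpcone B s V p ->
  exists2 t, has_history B r t & V i = final_mx d t /\ p i = pivots t.
Proof.
move=> [ts /rounds_history hts E].
have : List.In (s i, V i, p i) [seq (s i, V i, p i) | i <- enum 'I_k].
  by apply/List.in_map_iff; exists i; split=> //; apply: In_mem; rewrite mem_enum.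
by rewrite -E => /List.in_map_iff[t [[_ <- <-] /hts ht]]; exists t.
Qed.

Lemma simpcone_parallelepiped (R : realType) (n r d k : nat) (B : 'M[int]_(r, n + 1))
    (D : 'I_r -> int) (s : 'I_k -> int) (V : 'I_k -> 'M[rat]_(n + 1, d.+1))
    (p : 'I_k -> seq rat) (i : 'I_k) :
  (n + 1 = r + d.+1)%N -> smith_normal_form B D -> simpcone B s V p ->
  exists cWX : int * 'M[int]_(n + 1, d.+1) * seq 'cV[int]_(n + 1),
  [/\ 0 < cWX.1.1, map_mx intr cWX.1.2 = cWX.1.1%:~R *: V i, uniq cWX.2,
      forall z, z \in cWX.2 <-> half_open R cWX.1.2 (enum 'I_d.+1) z &
      (size cWX.2)%:R = cWX.1.1%:~R ^+ d.+1 *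
        `|(\prod_i D i)%:~R / \prod_(x <- p i) x| :> rat].
Proof.
move=> nr hD /(simpcone_history i)[t ht [Vi pi]].
have [T [TJ [h [detT hinj TE BV [detBT q0]]]]] := full_history ht nr.
have [c [W [c0 WV]]] := common_denominator (V i).
have detT1 : `|\det T| = 1 by rewrite detT normr1.
rewrite -Vi in TE BV; rewrite -pi in detBT q0.
have [X [uX XP sX]] :=
  smith_parallelepiped_cast R nr hD detT1 hinj TE BV detBT q0 c0 WV.
by exists (c, W, X).
Qed.

Theorem theorem5p7 (R : realType) (r n d : nat)
    (A : 'M[int]_(r, n)) (b : 'cV[int]_r)
    (hA : \rank (map_mx intr A : 'M[rat]_(r, n)) = r)
    (hd : d = (n - r)%N)
    (hbounded : coord_bounded (polyP R A b))
    (hdim : has_dimension (polyP R A b) d)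
    (D : 'I_r -> int)
    (hD : smith_normal_form (row_mx A (- b)) D)
    (k : nat) (s : 'I_k -> int) (V : 'I_k -> 'M[rat]_(n + 1, d.+1))
    (p : 'I_k -> seq rat)
    (halg : simpcone (row_mx A (- b)) s V p)
    (hdec : ratfun_eq_sum (sigma (coneP R (row_mx A (- b)))) s
                          (fun i => sigma (cone_gen R (V i))))
    (hrank : forall i, \rank (V i) = d.+1)
    (beta : 'cV[int]_n)
    (hbeta : forall i, admissible beta (V i))
    (hvol : cvgn (dilation_ratio (polyP R A b) d)) :
  relative_volume (polyP R A b) d =
    (d`!%:R)^-1 * \sum_(i < k) (s i)%:~R * ratr (Vol_hat D (p i) beta (V i)).
Proof.
have nr : (n + 1 = r + d.+1)%N.
  by have := rank_leq_col (map_mx intr A : 'M[rat]_(r, n)); rewrite hA hd; lia.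
have P0 : exists x, polyP R A b x by have [[x [Px _]] _] := hdim; exists (x ord0).
set v := relative_volume _ _.
have hv : dilation_ratio (polyP R A b) d @ \oo --> v by exact: hvol.
have [cWX cWXP] := choice (fun i => simpcone_parallelepiped R i nr hD halg).
pose c i := (cWX i).1.1; pose W i := (cWX i).1.2; pose X i := (cWX i).2.
have c0 i : 0 < c i by have [] := cWXP i.
have WV i : map_mx intr (W i) = (c i)%:~R *: V i by have [] := cWXP i.
have uX i : uniq (X i) by have [] := cWXP i.
have XP i z : z \in X i <-> half_open R (W i) (enum 'I_d.+1) z by have [] := cWXP i.
pose dens i : rat := `|(\prod_j D j)%:~R / \prod_(x <- p i) x|.
have sX i : (size (X i))%:R = (c i)%:~R ^+ d.+1 * dens i :> rat by have [] := cWXP i.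
have GX i : shift_diffs [seq col j (W i) | j <- enum 'I_d.+1]
    (sigma (cone_gen R (V i))) = fun z => (z \in X i)%:R.
  rewrite (sigma_cone_genE R (c0 i) (WV i)) shift_diffs_half_open ?enum_uniq //; last first.
    exact: row_full_intr (c0 i) (WV i) (hrank i).
  apply/funext => z; rewrite /half_open_series; congr (_%:R); congr nat_of_bool.
  by apply/asboolP/idP => /XP.
have [M betaM] := pairing_bound hbounded P0 beta.
have heightW i j : (height (col j (W i)))%:~R = (c i)%:~R * mu_m (V i) j :> rat.
  have := congr1 (fun Z : 'M[rat]_(n + 1, d.+1) => dsubmx Z 0 j) (WV i).
  by rewrite /height /mu_m !mxE.
have pairingW i j :
    (pairing beta (col j (W i)))%:~R = (c i)%:~R * beta_nu beta (V i) j :> rat.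
  rewrite /pairing /beta_nu !mxE rmorph_sum mulr_sumr /=; apply: eq_bigr => l _.
  rewrite !mxE intrM mulrCA; congr (_ * _).
  have := congr1 (fun Z : 'M[rat]_(n + 1, d.+1) => Z (lshift 1 l) j) (WV i).
  by rewrite !mxE.
have cQ i : (c i)%:~R != 0 :> rat by rewrite intr_eq0 gt_eqF.
have hp i j : ~ (height (col j (W i)) = 0 /\ pairing beta (col j (W i)) = 0).
  move=> [h0 p0]; apply: (hbeta i j); split.
    by apply: (mulfI (cQ i)); rewrite -pairingW p0 mulr0.
  by apply: (mulfI (cQ i)); rewrite -heightW h0 mulr0.
pose Pf i : {poly rat} := \prod_(j < d.+1) ((mu_m (V i) j)%:P - beta_nu beta (V i) j *: 'X).
have Pf0 i : Pf i != 0.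
  rewrite prodf_seq_neq0; apply/allP => j _ /=; apply/eqP => f0; apply: (hbeta i j).
  split.
    have := congr1 (fun f : {poly rat} => f`_1) f0.
    by rewrite /= coefB coefC coefZ coefX coef0 mulr1 sub0r => /eqP; rewrite oppr_eq0 => /eqP.
  have := congr1 (fun f : {poly rat} => f`_0) f0.
  by rewrite /= coefB coefC coefZ coefX coef0 mulr0 subr0.
(* For m >= [N0] a zero grade would mean (m + 1) x = y with |y| <= m, forcing x = y = 0 against
   admissibility. *)
pose N0 := (\sum_i \sum_j absz (pairing beta (col j (W i))))%N.
have gradeN0 m : (N0 <= m)%N -> forall i j, grade beta m.+1 (col j (W i)) != 0.
  move=> Nm i j; have : (absz (pairing beta (col j (W i))) <= m)%N.
    apply: leq_trans Nm; rewrite /N0 (bigD1 i) //= (bigD1 j) //= -addnA leq_addr //.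
  move: (hp i j); rewrite /grade; move: (height _) (pairing _ _) => x y xy ym.
  apply/eqP => /eqP; rewrite subr_eq0 => /eqP yE; apply: xy.
  have x0 : x = 0.
    apply/eqP; apply: contraTT ym => x0; rewrite -ltnNge -yE abszM.
    by rewrite leq_pmulr // absz_gt0.
  by rewrite -yE x0 mulr0.
(* At q = 1/(m+1) each denominator factor is c_i (m + 1) times a factor of [Pf i] at q. The powers
   of c_i cancel the scaling in [size (X i)], those of m + 1 the factor in front. *)
have polarE m : m.+1%:R ^+ d.+1 * polar_coef R s W X beta m.+1 =
    \sum_(i < k) ((s i)%:~R * ratr (dens i)) * (ratr (Pf i).[m.+1%:R^-1])^-1.
  rewrite mulr_sumr; apply: eq_bigr => i _.
  have m0 : (m.+1%:R : rat) != 0 by rewrite pnatr_eq0.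
  have gE j : (grade beta m.+1 (col j (W i)))%:~R =
      (c i)%:~R * m.+1%:R * (mu_m (V i) j - beta_nu beta (V i) j * m.+1%:R^-1) :> rat.
    by rewrite /grade rmorphB rmorphM /= heightW pairingW; field.
  have prodE : \prod_(j < d.+1) (grade beta m.+1 (col j (W i)))%:~R =
      ratr ((c i)%:~R ^+ d.+1 * m.+1%:R ^+ d.+1 * (Pf i).[m.+1%:R^-1]) :> R.
    have -> : (Pf i).[m.+1%:R^-1] =
        \prod_(j < d.+1) (mu_m (V i) j - beta_nu beta (V i) j * m.+1%:R^-1).
      by rewrite horner_prod; apply: eq_bigr => j _; rewrite !hornerE.
    have -> : (c i)%:~R ^+ d.+1 = \prod_(j < d.+1) (c i)%:~R :> rat by rewrite prodr_const card_ord.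
    rewrite [(m.+1%:R) ^+ _](_ : _ = \prod_(j < d.+1) m.+1%:R); last first.
      by rewrite prodr_const card_ord.
    rewrite -!big_split /= rmorph_prod.
    by apply: eq_bigr => j _; rewrite -gE /= ratr_int.
  have -> : (size (X i))%:R = ratr (size (X i))%:R :> R by rewrite ratr_nat.
  rewrite prodE sX !rmorphM /= !rmorphXn /= ratr_nat.
  have mR : (m.+1%:R : R) != 0 by rewrite pnatr_eq0.
  have cR : ratr (c i)%:~R != 0 :> R by rewrite fmorph_eq0.
  move: (ratr (Pf i).[_]) (ratr (dens i)) ((s i)%:~R) => x y z.
  rewrite !invfM; move: (expf_neq0 d.+1 mR) (expf_neq0 d.+1 cR).
  move: (_ ^+ d.+1) (_ ^+ d.+1) => a a' a0 a'0; move: (x^-1) => x'.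
  by field; rewrite a0 a'0.
(* Given this limit, [CTq_inv_limit] identifies it with the combination of constant terms. *)
suff lim : (fun m => \sum_(i < k) ((s i)%:~R * ratr (dens i)) *
    (ratr (Pf i).[m.+1%:R^-1])^-1) @ \oo --> v * d`!%:R.
  have := CTq_inv_limit Pf0 lim.
  under eq_bigr => i _ do rewrite -mulrA -rmorphM.
  move=> E; rewrite /Vol_hat.
  under eq_bigr => i _ do rewrite -/(Pf i) -/(dens i).
  by rewrite E mulrC mulfK // pnatr_eq0 -lt0n fact_gt0.
(* With e = M and e = -M these are the bounds v d! / (1 + e/(m+1))^(d+1) extracted from the sandwich
   at N = m + 1. *)
have cvM (e : R) : (fun m => v * d`!%:R * ((1 + e * m.+1%:R^-1)^-1) ^+ d.+1) @ \oo -->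
    v * d`!%:R.
  rewrite -[X in _ --> X]mulr1; apply: cvgM; first exact: cvg_cst.
  suff : (fun m => ((1 + e * m.+1%:R^-1)^-1) ^+ d.+1) @ \oo --> ((1 + e * 0)^-1) ^+ d.+1.
    by rewrite mulr0 addr0 invr1 expr1n.
  apply: (cvg_comp (fun m => (1 + e * m.+1%:R^-1)^-1) (fun x : R => x ^+ d.+1)).
    apply: (@cvgV R _ _ _ _ (1 + e * 0)); first by rewrite mulr0 addr0 oner_neq0.
    apply: cvgD; first exact: cvg_cst.
    by apply: cvgM; [exact: cvg_cst|exact: cvg_invn].
  exact: exprn_continuous.
apply: squeeze_cvgr (cvM M%:R) (cvM (- M%:R)).
exists (N0 + M)%N => // m /= Nm.
have MN : (M < m.+1)%N by rewrite ltnS (leq_trans _ Nm) // leq_addl.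
have Nm' : (N0 <= m)%N by rewrite (leq_trans _ Nm) // leq_addr.
have := volume_sandwich hbounded P0 GX uX hdec hv betaM MN (gradeN0 m Nm').
rewrite -polarE; move: (polar_coef _ _ _ _ _ _) (v * _) => x w.
have mR : 0 < m.+1%:R :> R by rewrite ltr0n.
have shiftE (K : nat) (e : R) : K%:R = m.+1%:R * (1 + e * m.+1%:R^-1) -> (0 < K)%N ->
    ((1 + e * m.+1%:R^-1)^-1) ^+ d.+1 = m.+1%:R ^+ d.+1 / K%:R ^+ d.+1.
  move=> KE K0; have KR : K%:R != 0 :> R by rewrite pnatr_eq0 -lt0n.
  rewrite -expr_div_n; congr (_ ^+ _); rewrite KE invfM mulVKf // gt_eqF //.
rewrite (shiftE (m.+1 + M)%N) ?(shiftE (m.+1 - M)%N) ?subn_gt0 //; last 2 first.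
- by rewrite natrB ?(ltnW MN) //; field; rewrite gt_eqF.
- by rewrite natrD; field; rewrite gt_eqF.
have mD : 0 < m.+1%:R ^+ d.+1 :> R by rewrite exprn_gt0.
move=> /andP[h1 h2]; apply/andP; split.
- rewrite mulrCA ler_wpM2l ?(ltW mD) // ler_pdivrMr 1?mulrC //.
- rewrite mulrCA ler_wpM2l ?(ltW mD) // ler_pdivlMr 1?mulrC //.
  by rewrite exprn_gt0 // ltr0n subn_gt0.
Qed.
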